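(* Let $\mathbb{F}_q$ be a finite field and let $0\le k\le n$ be integers, $n\ge 1$. Let $\omega_{2nk}=L^2(M_{n,k}(\mathbb{F}_q))\simeq\sum_{\nu\in\widehat{GL}_k}\Xi_\nu\otimes\nu$ be the representation of $GL_n\times GL_k$ described in the context. Then the domain of the eta correspondence $\nu\mapsto\eta(\nu)$ is $(\widehat{GL}_k)_{new,\ge 2k-n}$. In particular, for every $\nu$ in $(\widehat{GL}_k)_{new,\ge 2k-n}$ there is a unique irreducible representation $\eta(\nu)$ in $\Xi_\nu$ which belongs to the new $k$-spectrum $(\widehat{GL}_n)_{new,k}$; it appears in $\Xi_\nu$ with multiplicity one, and the other irreducible components of $\Xi_\nu$ belong to lower new spectrum (i.e. to $(\widehat{GL}_n)_{new,l}$ with $l<k$).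
   Context: All representations are finite dimensional and complex; $\widehat G$ is the set of isomorphism classes of irreducible representations of a finite group $G$. $GL_n=GL_n(\mathbb{F}_q)$, and $GL_0$ is the trivial group. The representation $\omega_{2nk}$: it is the restriction to the dual pair $GL_n\times GL_k\subset Sp_{2nk}$ of the oscillator (Weil) representation, realized as the permutation representation on the space $L^2(M_{n,k})$ of complex functions on the $n\times k$ matrices over $\mathbb{F}_q$, with $GL_n$ acting by left multiplication of matrices and $GL_k$ by right multiplication. For $\nu\in\widehat{GL}_k$, $\Xi_\nu=\mathrm{Hom}_{GL_k}(\nu,\omega_{2nk})$, a representation of $GL_n$ (possibly zero). New spectrum: for integers $m\ge 0$, $l\ge 0$, let $\widehat{GL}_m(\omega_{2ml})$ be the set of irreducible representations of $GL_m$ that appear in $\omega_{2ml}=L^2(M_{m,l})$. These sets increase with $l$, and every irreducible representation of $GL_m$ belongs to $\widehat{GL}_m(\omega_{2m^2})$. The new $l$-spectrum of $GL_m$ is $(\widehat{GL}_m)_{new,l}=\widehat{GL}_m(\omega_{2ml})\smallsetminus\widehat{GL}_m(\omega_{2m(l-1)})$ (for $l=0$ it consists of the trivial representation). For an integer $r$, $(\widehat{GL}_k)_{new,\ge r}$ is the set of irreducible representations of $GL_k$ that lie in the new $l$-spectrum of $GL_k$ for some $l\ge r$. $(\omega_{2nk})^{new}_{GL_n}\subset\omega_{2nk}$ is the sum of the $GL_n$-isotypic components of members of $(\widehat{GL}_n)_{new,k}$. Eta correspondence (known fact): on $(\omega_{2nk})^{new}_{GL_n}$ the algebras generated by $GL_n$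 and by $GL_k$ are each other's commutant. Hence each $\Xi_\nu$ contains at most one member of $(\widehat{GL}_n)_{new,k}$, with multiplicity at most one; the domain of the eta correspondence is the set of $\nu\in\widehat{GL}_k$ for which $\Xi_\nu$ contains such a member, and $\eta(\nu)$ denotes that member. The map $\nu\mapsto\eta(\nu)$ is a bijection from its domain onto $(\widehat{GL}_n)_{new,k}$. *)

(* Defs.v *)
(* Representations are matrix representations over algC, the field of complex
   scalars of MathComp's character theory.  The isomorphism class of rG is the
   similarity class of the homomorphism x |-> rG x, whose character is
   x |-> \tr (rG x); it does not depend on whether the matrices rG x are
   applied to row vectors (as in the library's module theory) or to columns. *)
From HB Require Import structures.
From mathcomp Require Import all_boot all_order all_algebra all_fingroup.
From mathcomp Require Import all_solvable all_field all_character.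

Set Implicit Arguments.
Unset Strict Implicit.
Unset Printing Implicit Defensive.

Import Order.TTheory GRing.Theory Num.Theory GroupScope.
Local Open Scope ring_scope.

(* The library's {'GL_n[F]} consists of matrices of size n.-1.+1, so that
   {'GL_0[F]} is F^*; here GL F 0 is the trivial group. *)
Record GL (F : finFieldType) (n : nat) := MkGL {
  GLmx :> 'M[F]_n;
  GLmx_unit : GLmx \in unitmx
}.

HB.instance Definition _ F n := [isSub for @GLmx F n].
HB.instance Definition _ F n := [Finite of GL F n by <:].

Section GLGroup.
Variables (F : finFieldType) (n : nat).

Fact GL_mul_subproof (g h : GL F n) : GLmx g *m GLmx h \in unitmx.
Proof. by rewrite unitmx_mul !GLmx_unit. Qed.
Definition GL_mul (g h : GL F n) : GL F n := MkGL (GL_mul_subproof g h).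

Fact GL_one_subproof : (1%:M : 'M[F]_n) \in unitmx.
Proof. exact: unitmx1. Qed.
Definition GL_one : GL F n := MkGL GL_one_subproof.

Fact GL_inv_subproof (g : GL F n) : invmx (GLmx g) \in unitmx.
Proof. by rewrite unitmx_inv GLmx_unit. Qed.
Definition GL_inv (g : GL F n) : GL F n := MkGL (GL_inv_subproof g).

Fact GL_mulA : associative GL_mul.
Proof. by move=> g h k; apply: val_inj; exact: mulmxA. Qed.
Fact GL_mul1 : left_id GL_one GL_mul.
Proof. by move=> g; apply: val_inj; exact: mul1mx. Qed.
Fact GL_mulV : left_inverse GL_one GL_inv GL_mul.
Proof. by move=> g; apply: val_inj; apply: mulVmx; exact: GLmx_unit. Qed.

HB.instance Definition _ :=
  Finite_isGroup.Build (GL F n) GL_mulA GL_mul1 GL_mulV.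

Lemma GLmxM (g h : GL F n) : GLmx (g * h)%g = GLmx g *m GLmx h.
Proof. by []. Qed.
Lemma GLmx1 : GLmx (1%g : GL F n) = 1%:M.
Proof. by []. Qed.
Lemma GLmxV (g : GL F n) : GLmx g^-1%g = invmx (GLmx g).
Proof. by []. Qed.
Lemma invGLmxM (g h : GL F n) :
  invmx (GLmx g *m GLmx h) = invmx (GLmx h) *m invmx (GLmx g).
Proof. by rewrite -GLmxM -!GLmxV invMg. Qed.

End GLGroup.

(* The isomorphism classes of irreducible representations of GL_n, indexed by
   the irreducible characters. *)
Notation GLhat F n := (Iirr [set: GL F n]).

Section Oscillator.
Variables (F : finFieldType) (n k : nat).

Local Notation M := 'M[F]_(n, k).
Local Notation N := #|{: M}|.

(* The operator (omega (g, h) f) X = f (g^-1 X h) on complex functions on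
   M_{n,k}, written in the basis of delta functions: it maps the delta function
   at X to the one at g X h^-1. *)
Definition omega_mx (gh : GL F n * GL F k) : 'M[algC]_N :=
  \matrix_(i, j)
    (enum_val i == GLmx gh.1 *m enum_val j *m invmx (GLmx gh.2))%:R.

Lemma omega_mx1 : omega_mx (1%g, 1%g) = 1%:M.
Proof.
apply/matrixP=> i j; rewrite !mxE /=.
by rewrite mul1mx invmx1 mulmx1 (inj_eq enum_val_inj).
Qed.

Lemma omega_mxM (g1 g2 : GL F n) (h1 h2 : GL F k) :
  omega_mx ((g1 * g2)%g, (h1 * h2)%g)
    = omega_mx (g1, h1) *m omega_mx (g2, h2).
Proof.
apply/matrixP=> i j; rewrite !mxE /=.
pose X0 : M := GLmx g2 *m enum_val j *m invmx (GLmx h2).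
rewrite (bigD1 (enum_rank X0)) //= big1 => [|l neq_l].
  rewrite !mxE enum_rankK eqxx mulr1 addr0 /X0 /=.
  by rewrite invGLmxM -!mulmxA.
rewrite !mxE /= -/X0 (_ : (enum_val l == X0) = false) ?mulr0 //.
by apply: contraNF neq_l => /eqP<-; rewrite enum_valK.
Qed.

Lemma omega_mx_repr : mx_repr [set: GL F n * GL F k] omega_mx.
Proof.
split=> [|[g1 h1] [g2 h2] _ _]; first exact: omega_mx1.
exact: omega_mxM.
Qed.
Canonical omega := MxRepresentation omega_mx_repr.

Lemma omega_left_repr :
  mx_repr [set: GL F n] (fun g => omega_mx (g, 1%g)).
Proof.
split=> [|g1 g2 _ _]; first exact: omega_mx1.
by rewrite -omega_mxM (mul1g (1%g : GL F k)).
Qed.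
Definition omega_left := MxRepresentation omega_left_repr.

Lemma omega_right_repr :
  mx_repr [set: GL F k] (fun h => omega_mx (1%g, h)).
Proof.
split=> [|h1 h2 _ _]; first exact: omega_mx1.
by rewrite -omega_mxM (mul1g (1%g : GL F n)).
Qed.
Definition omega_right := MxRepresentation omega_right_repr.

Lemma omega_leftC (g : GL F n) (h : GL F k) :
  omega_left g *m omega_right h = omega_right h *m omega_left g.
Proof.
rewrite /= -!omega_mxM (mulg1 (g : GL F n)) (mul1g (g : GL F n)).
by rewrite (mulg1 (h : GL F k)) (mul1g (h : GL F k)).
Qed.

End Oscillator.

(* Intertwining matrices between two representations of G (acting on row
   vectors), as a subspace of 'M_(d, e) flattened by mxvec. *)
Section HomSpace.
Variables (gT : finGroupType) (G : {group gT}) (d e : nat).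
Variables (rU : mx_representation algC G d) (rV : mx_representation algC G e).

Definition homG_mx : 'M[algC]_(d * e) :=
  (\bigcap_(h in G) kermx (lin_mulmx (rU h) - lin_mulmxr (rV h)))%MS.

Lemma homG_mxP (A : 'M[algC]_(d, e)) :
  reflect (forall h, h \in G -> rU h *m A = A *m rV h)
          (mxvec A <= homG_mx)%MS.
Proof.
apply: (iffP sub_bigcapmxP) => homA h Gh.
  have /sub_kermxP := homA h Gh.
  rewrite mulmxBr !mul_vec_lin /= -linearB => /(canRL mxvecK)/eqP.
  by rewrite linear0 subr_eq0 => /eqP.
by apply/sub_kermxP; rewrite mulmxBr !mul_vec_lin /= homA ?subrr.
Qed.

End HomSpace.

Lemma mul_rV_mulmxr (p q r : nat) (B : 'M[algC]_(q, r)) (u : 'rV_(p * q)) :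
  u *m lin_mulmxr B = mxvec (vec_mx u *m B).
Proof. exact: mul_rV_lin. Qed.

Section Xi.
Variables (F : finFieldType) (n k : nat) (nu : GLhat F k).

Local Notation N := #|{: 'M[F]_(n, k)}|.
Local Notation d := (irr_degree (socle_of_Iirr nu)).

(* GL_n acts on linear maps A : nu -> omega by postcomposition; in the row
   vector convention this is multiplication of A on the right. *)
Lemma postcomp_repr :
  mx_repr [set: GL F n]
    (fun g => lin_mulmxr (omega_left F n k g) : 'M[algC]_(d * N)).
Proof.
split=> [|g1 g2 _ _]; apply/row_matrixP=> i; rewrite !rowE.
  by rewrite mul_rV_mulmxr repr_mx1 !mulmx1 vec_mxK.
by rewrite mulmxA !mul_rV_mulmxr mxvecK repr_mxM ?inE // mulmxA.
Qed.
Definition postcomp := MxRepresentation postcomp_repr.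

Definition Xi_space : 'M[algC]_(d * N) := homG_mx 'Chi_nu (omega_right F n k).

Lemma Xi_mxmodule : mxmodule postcomp Xi_space.
Proof.
apply/mxmoduleP=> g _; apply/row_subP=> i.
rewrite row_mul mul_rV_mulmxr.
have /homG_mxP homA : (mxvec (vec_mx (row i Xi_space)) <= Xi_space)%MS.
  by rewrite vec_mxK row_sub.
apply/homG_mxP=> h Gh.
by rewrite mulmxA homA // -!mulmxA -omega_leftC.
Qed.

(* Xi_nu = Hom_{GL_k}(nu, omega), as a representation of GL_n. *)
Definition Xi : mx_representation algC [set: GL F n] (\rank Xi_space) :=
  submod_repr Xi_mxmodule.

End Xi.

Definition appears (gT : finGroupType) (G : {group gT}) (d : nat)
    (rV : mx_representation algC G d) (rho : Iirr G) : bool :=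
  rho \in irr_constt (cfRepr rV).

Definition multiplicity (gT : finGroupType) (G : {group gT}) (d : nat)
    (rV : mx_representation algC G d) (rho : Iirr G) : algC :=
  '[cfRepr rV, 'chi_rho].

Definition spectrum (F : finFieldType) (m l : nat) : {set GLhat F m} :=
  [set rho | appears (omega_left F m l) rho].

(* The index 0 is that of the trivial representation. *)
Definition new_spectrum (F : finFieldType) (m l : nat) : {set GLhat F m} :=
  if l is l'.+1 then spectrum F m l :\: spectrum F m l' else [set 0].

Definition in_new_spectrum_ge (F : finFieldType) (m : nat) (r : int)
    (nu : GLhat F m) : Prop :=
  exists l : nat, (r <= l%:Z)%R /\ nu \in new_spectrum F m l.

(* rho is a value eta(nu) of the eta correspondence. *)
Definition is_eta (F : finFieldType) (n k : nat) (nu : GLhat F k)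
    (rho : GLhat F n) : Prop :=
  appears (Xi n nu) rho /\ rho \in new_spectrum F n k.

Definition in_eta_domain (F : finFieldType) (n k : nat) (nu : GLhat F k) :
    Prop :=
  exists rho : GLhat F n, is_eta nu rho.

(* Main.v *)
(* Call a function on M_{n,k} new if it is killed by every GL_n-equivariant map
   to functions on M_{n,k-1}.  A GL_n-invariant kernel K(X, Y) is a combination
   of the indicators of the linear relations X P = Y Q, because it depends only
   on the row space of (X | Y).  Such an indicator kills new functions unless
   Q is row free, and it then acts as 0 or as some h in GL_k.  So on the new
   part the commutant of GL_n is spanned by GL_k; comparing the trace of
   GL_n x GL_k on its nu-isotypic part with that of its commutant, the scalars,
   gives sum_rho m(rho, nu)^2 = 1 over the new rho, unless all of them vanish.

   For the domain, recall that nu occurs in L^2(M_{k,r}) iff nu has nonzero sum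
   over the stabilizer in GL_k of some J in M_{k,r}.
   - If r = 2k - n - 1, the sum over {X : X J = X0 J} of f(X) z(X)^i, where z(X)
     is the number of solutions u of (X | X0) u = 0, vanishes for f new and i < k - r.
     The values of z are q^(r+1), ..., q^k, and a polynomial in z of degree
     k - r - 1 isolates q^k, that is, X in X0 GL_k.  Hence the sum of f(X0 h)
     over the stabilizer of J vanishes, and no nu occurring in L^2(M_{k,r}) is
     in the domain.
   - If nu does not occur in L^2(M_{k,2k-n-1}), then new_vector below is a new
     function on which the nu-isotypic projection does not vanish. *)
Require Import Defs.
From mathcomp Require Import all_boot all_order all_algebra all_fingroup.
From mathcomp Require Import all_solvable all_field all_character.
From mathcomp Require Import ring zify.
Set Implicit Arguments.
Unset Strict Implicit.
Unset Printing Implicit Defensive.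
Import Order.TTheory GRing.Theory Num.Theory.
Local Open Scope ring_scope.

(** * Idempotents, isotypic projections and class sums *)

(** In a full-rank factorization E = C R', idempotency forces R' C = 1, so that C R' has the trace
    of an identity matrix of size [\rank E]. *)
Lemma mxtrace_idem (R : fieldType) n (E : 'M[R]_n) :
  E *m E = E -> \tr E = (\rank E)%:R.
Proof.
move=> EE.
have := mulmx_base E; have := row_base_free E; have := col_base_full E.
move: (col_base E) (row_base E) => C R' Cfull Rfree CR.
have RC1 : R' *m C = 1%:M.
  apply: (row_free_inj Rfree); apply: (row_full_inj Cfull).
  by rewrite /= mul1mx !mulmxA CR -mulmxA CR.
by rewrite -[E in \tr E]CR mxtrace_mulC RC1 mxtrace1.
Qed.

Section IsotypicProjection.
Variables (gT : finGroupType) (d : nat).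
Variable rG : mx_representation algC [set: gT] d.

Definition isotypic_proj (i : Iirr [set: gT]) : 'M[algC]_d :=
  ('chi_i 1%g / #|gT|%:R) *: \sum_(x : gT) 'chi_i x^-1%g *: rG x.

Lemma neq0_card : #|gT|%:R != 0 :> algC.
Proof. by rewrite -cardsT neq0CG. Qed.

Lemma sum_chi_mulV (i j : Iirr [set: gT]) (y : gT) :
  \sum_(x : gT) 'chi_i (x * y)%g * 'chi_j x^-1%g
    = #|gT|%:R * ((i == j)%:R * ('chi_i y / 'chi_i 1%g)).
Proof.
rewrite -generalized_orthogonality_relation cardsT mulrA divff ?neq0_card //.
by rewrite mul1r; apply: eq_bigl => x; rewrite inE.
Qed.

Lemma isotypic_projM i j :
  isotypic_proj i *m isotypic_proj j = (i == j)%:R *: isotypic_proj i.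
Proof.
rewrite /isotypic_proj -scalemxAl -scalemxAr mulmx_suml.
under eq_bigr do rewrite mulmx_sumr.
rewrite exchange_big /=.
under eq_bigr => y _.
  rewrite (reindex_inj (mulIg y^-1%g)) /=.
  under eq_bigr => z _.
    rewrite invMg invgK -scalemxAl -scalemxAr scalerA -repr_mxM ?inE //.
    rewrite mulgKV; over.
  over.
rewrite exchange_big /=.
have := irr1_neq0 j; have := irr1_neq0 i; have := neq0_card => nzG nzi nzj.
rewrite !scaler_sumr; apply: eq_bigr => z _.
rewrite -scaler_suml sum_chi_mulV !scalerA; congr (_ *: _).
have [<- | _] := eqVneq i j; last by rewrite !(mulr0, mul0r).
by rewrite !mul1r; field; rewrite nzG nzi.
Qed.

Lemma isotypic_projC i g : rG g *m isotypic_proj i = isotypic_proj i *m rG g.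
Proof.
rewrite /isotypic_proj -scalemxAl -scalemxAr mulmx_suml mulmx_sumr.
congr (_ *: _); rewrite (reindex_inj (@conjg_inj _ g)) /=; apply: eq_bigr => x _.
rewrite -scalemxAl -scalemxAr -!repr_mxM ?inE // -conjgC -conjVg.
by rewrite cfunJ ?inE.
Qed.

Lemma sum_isotypic_proj : \sum_i isotypic_proj i = 1%:M.
Proof.
rewrite /isotypic_proj.
under eq_bigr => i _.
  rewrite scaler_sumr; under eq_bigr do rewrite scalerA; over.
have sum_chi1 x : \sum_i 'chi[[set: gT]]_i 1%g * 'chi_i x^-1%g = #|gT|%:R *+ (x == 1%g).
  under eq_bigr do rewrite irr_inv.
  rewrite second_orthogonality_relation ?inE // class_sym class1G inE.
  by rewrite cent11T setIT cardsT.
rewrite exchange_big /= (bigD1 1%g) //= [X in _ + X]big1 => [|x x1].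
  rewrite addr0 -scaler_suml repr_mx1.
  under eq_bigr do rewrite mulrAC.
  by rewrite -mulr_suml sum_chi1 eqxx mulr1n divff ?neq0_card ?scale1r.
rewrite -scaler_suml; under eq_bigr do rewrite mulrAC.
by rewrite -mulr_suml sum_chi1 (negPf x1) mul0r scale0r.
Qed.

(** By Schur's lemma the sum of the conjugates of [h] acts on ['Chi_i] as a scalar, and traces
    determine this scalar. *)
Lemma sum_chi_conj (i : Iirr [set: gT]) (y h : gT) :
  \sum_(z : gT) 'chi_i (y * h ^ z)%g = #|gT|%:R * ('chi_i y * 'chi_i h / 'chi_i 1%g).
Proof.
pose B := \sum_(z : gT) 'Chi_i (h ^ z)%g.
have [b Bb] : exists b, B = b%:M.
  apply/is_scalar_mxP; apply: mx_abs_irr_cent_scalar.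
    by apply/groupC/socle_irr.
  apply/centgmxP=> x _; rewrite mulmx_suml mulmx_sumr.
  rewrite [RHS](reindex_inj (mulIg x)) /=; apply: eq_bigr => z _.
  by rewrite -!repr_mxM ?inE // conjgM -conjgC.
have chiE x : 'chi_i x = \tr ('Chi_i x) by rewrite -irrRepr cfunE inE mulr1n.
have trB : \tr B = #|gT|%:R * 'chi_i h.
  rewrite /B raddf_sum /=; under eq_bigr => z _ do rewrite -chiE cfunJ ?inE //.
  by rewrite sumr_const mulr_natl.
transitivity (\tr ('Chi_i y *m B)).
  rewrite /B mulmx_sumr raddf_sum /=; apply: eq_bigr => z _.
  by rewrite -repr_mxM ?inE // chiE.
have bE : b * 'chi_i 1%g = #|gT|%:R * 'chi_i h.
  by rewrite chiE repr_mx1 mxtrace1 -trB Bb mxtrace_scalar mulr_natr.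
rewrite Bb mul_mx_scalar mxtraceZ -chiE.
by rewrite !mulrA [_ * 'chi_i y]mulrC -(mulrA _ _ ('chi_i h)) -bE mulrA mulfK
  ?irr1_neq0 // mulrC.
Qed.

(** A class sum acts on an isotypic component by its central character. This is what later turns
    elements of GL_k in a commutant into scalars. *)
Lemma sum_conj_isotypic_proj i (h : gT) :
  (\sum_(z : gT) rG (h ^ z)%g) *m isotypic_proj i
    = (#|gT|%:R * ('chi_i h / 'chi_i 1%g)) *: isotypic_proj i.
Proof.
have scalC a b (v : 'M[algC]_d) : a *: (b *: v) = b *: (a *: v).
  by rewrite !scalerA mulrC.
rewrite /isotypic_proj -scalemxAr [RHS]scalC; congr (_ *: _).
rewrite mulmx_suml; under eq_bigr => z _.
  rewrite mulmx_sumr (reindex_inj (mulgI (h ^ z)^-1%g)) /=.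
  under eq_bigr => y _.
    rewrite invMg invgK -scalemxAr -repr_mxM ?inE // mulKVg; over.
  over.
rewrite exchange_big scaler_sumr /=; apply: eq_bigr => y _.
rewrite -scaler_suml sum_chi_conj scalerA; congr (_ *: _); ring.
Qed.

End IsotypicProjection.

(** * Traces on commutants, submodules and spaces of intertwiners *)

Lemma mul_delta_mxE (R : comNzRingType) m n p q (A : 'M[R]_(m, n)) (B : 'M_(p, q))
    i j k l : (A *m delta_mx i j *m B) k l = A k i * B j l.
Proof.
rewrite mxE (bigD1 j) //= big1 => [|s sj]; rewrite mxE (bigD1 i) //= big1 ?mxE.
- by rewrite !eqxx mulr1 !addr0.
- by move=> t ti; rewrite mxE (negPf ti) mulr0.
- by rewrite (negPf sj) andbF mulr0 addr0 mul0r.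
by move=> t ti; rewrite mxE (negPf ti) mulr0.
Qed.

(* The averages over the group of the conjugates of the matrix units span the
   commutant; the identity compares their traces against E. *)
Lemma trace_scalar_commutant (gT : finGroupType) (d : nat)
    (rG : mx_representation algC [set: gT] d) (E : 'M[algC]_d) :
    E *m E = E -> (forall x, rG x *m E = E *m rG x) ->
    (forall T : 'M[algC]_d, (forall x, rG x *m T = T *m rG x) ->
       exists c : algC, T *m E = c *: E) ->
  \tr E * \sum_(x : gT) \tr (rG x) * \tr (rG x^-1%g *m E) = #|gT|%:R * \tr E.
Proof.
move=> EE Ecomm Tscal.
pose T i j := \sum_(x : gT) rG x *m delta_mx i j *m rG x^-1%g.
have mulVx (x : gT) : rG x^-1%g *m rG x = 1%:M.
  by rewrite -repr_mxM ?inE // mulVg repr_mx1.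
have Tcomm i j x : rG x *m T i j = T i j *m rG x.
  rewrite /T mulmx_suml mulmx_sumr [RHS](reindex_inj (mulgI x)) /=.
  apply: eq_bigr => y _; rewrite invMg !repr_mxM ?inE // !mulmxA.
  by rewrite -(mulmxA _ (rG x^-1%g)) mulVx mulmx1.
have TEE i j k l :
    (T i j *m E) k l = \sum_(x : gT) rG x k i * (rG x^-1%g *m E) j l.
  rewrite /T mulmx_suml summxE; apply: eq_bigr => x _.
  by rewrite -mulmxA mul_delta_mxE.
have trTE i j : \tr (T i j *m E) = #|gT|%:R * E j i.
  rewrite /mxtrace; under eq_bigr do rewrite TEE.
  rewrite exchange_big /= -sum1_card natr_sum mulr_suml; apply: eq_bigr => x _.
  rewrite mul1r; transitivity ((rG x^-1%g *m E *m rG x) j i).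
    by rewrite mxE; apply: eq_bigr => k _; rewrite mulrC.
  by rewrite -mulmxA -Ecomm mulmxA mulVx mul1mx.
(* The scalar is eliminated through [trTE]: c times the trace of [E] is the order of the group times
   [E j i]. *)
have TEij i j : \tr E * (T i j *m E) i j = #|gT|%:R * (E i j * E j i).
  have [c TE] := Tscal _ (Tcomm i j); have := trTE i j.
  by rewrite TE mxtraceZ mxE mulrCA mulrA => ->; rewrite -mulrA [E j i * _]mulrC.
transitivity (\tr E * \sum_i \sum_j (T i j *m E) i j).
  congr (_ * _); under [RHS]eq_bigr => i _.
    under eq_bigr do rewrite TEE; rewrite exchange_big /=.
    under eq_bigr do rewrite -mulr_sumr; over.
  by rewrite exchange_big /=; apply: eq_bigr => x _; rewrite -mulr_suml.
rewrite mulr_sumr; under eq_bigr => i _.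
  rewrite mulr_sumr; under eq_bigr do rewrite TEij.
  rewrite -mulr_sumr; over.
rewrite -mulr_sumr -[in RHS]EE; congr (_ * _).
by apply: eq_bigr => i _; rewrite mxE.
Qed.

(** [P] is a projection onto [U]. It factors through coordinates on [U], and the factors multiplied
    in the other order give the identity. *)
Lemma mxtrace_submod (gT : finGroupType) (G : {group gT}) (d : nat)
    (rG : mx_representation algC G d) (U P : 'M_d) (Umod : mxmodule rG U) x :
    x \in G -> (P <= U)%MS -> U *m P = U ->
  \tr (submod_repr Umod x) = \tr (P *m rG x).
Proof.
move=> Gx PU UP; have PE := in_submodK PU.
have valUP : val_submod (1%:M : 'M_(\rank U)) *m P = val_submod 1%:M.
  have /submxP[D ->] : (val_submod (1%:M : 'M_(\rank U)) <= U)%MS by rewrite val_submodP.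
  by rewrite -mulmxA UP.
have SR := val_submodJ Umod 1%:M Gx; rewrite mul1mx val_submodE in SR.
have RP1 : val_submod 1%:M *m in_submod U P = 1%:M.
  by rewrite (in_submodE U P) mulmxA valUP -in_submodE val_submodK.
rewrite -[in RHS]PE val_submodE -[in RHS]mulmxA -SR [RHS]mxtrace_mulC.
by rewrite -[in RHS](mulmxA (submod_mx _ _)) RP1 mulmx1.
Qed.

(** The matrix unit at (i, j) is sent to a matrix whose (i, j) entry is [B i i * C j j]. *)
Lemma mxtrace_lin_mul (R : comNzRingType) m n (B : 'M[R]_m) (C : 'M[R]_n) :
  \tr (lin_mulmx B *m lin_mulmxr C : 'M_(m * n)) = \tr B * \tr C.
Proof.
pose M := lin_mulmx B *m lin_mulmxr C; rewrite -/M.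
transitivity (\sum_i \sum_j M (mxvec_index i j) (mxvec_index i j)).
  rewrite pair_bigA /mxtrace (reindex _ (@curry_mxvec_bij m n)) /=.
  by apply: eq_bigr => [[i j] _].
rewrite mulr_suml; apply: eq_bigr => i _; rewrite mulr_sumr; apply: eq_bigr => j _.
have -> : M (mxvec_index i j) (mxvec_index i j) = (B *m delta_mx i j *m C) i j.
  rewrite -[RHS]mxvecE -[in RHS]mulmxA.
  transitivity (((delta_mx 0 (mxvec_index i j) : 'rV_(m * n)) *m M) 0 (mxvec_index i j)).
    by rewrite -rowE [RHS]mxE.
  by rewrite -mxvec_delta /M mulmxA !mul_vec_lin /= mulmxA.
by rewrite mul_delta_mxE.
Qed.

Section HomAverage.
Variables (gT : finGroupType) (d e : nat).
Variables (rU : mx_representation algC [set: gT] d).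
Variables (rV : mx_representation algC [set: gT] e).

(** Right multiplication by this matrix is the projection onto the intertwiners that sends [A] to
    the mean of rU h^-1 A rV h. It gives access to the character of [Xi]. *)
Definition hom_average : 'M[algC]_(d * e) :=
  #|gT|%:R^-1 *: \sum_(h : gT) lin_mulmx (rU h^-1%g) *m lin_mulmxr (rV h).

Lemma mul_hom_average A :
  mxvec A *m hom_average
    = #|gT|%:R^-1 *: mxvec (\sum_(h : gT) rU h^-1%g *m A *m rV h).
Proof.
rewrite /hom_average -scalemxAr; congr (_ *: _).
rewrite mulmx_sumr [RHS]linear_sum /=; apply: eq_bigr => h _.
by rewrite mulmxA !mul_vec_lin.
Qed.

Lemma hom_average_sub : (hom_average <= homG_mx rU rV)%MS.
Proof.
apply/row_subP=> i; rewrite rowE; set u := delta_mx _ _.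
rewrite -[u]vec_mxK mul_hom_average scalemx_sub //.
apply/homG_mxP => x _; rewrite mulmx_sumr mulmx_suml.
rewrite (reindex_inj (mulIg x)) /=; apply: eq_bigr => h _.
rewrite invMg !mulmxA -(repr_mxM rU) ?inE // mulKVg -[RHS]mulmxA.
by rewrite -(repr_mxM rV) ?inE.
Qed.

Lemma hom_average_id : homG_mx rU rV *m hom_average = homG_mx rU rV.
Proof.
apply/row_matrixP=> i; rewrite row_mul.
have : (row i (homG_mx rU rV) <= homG_mx rU rV)%MS by rewrite row_sub.
rewrite -[row i _]vec_mxK => /homG_mxP homA.
rewrite mul_hom_average; under eq_bigr => h _.
  rewrite -mulmxA -homA ?inE // mulmxA -repr_mxM ?inE // mulVg repr_mx1 mul1mx.
  over.
by rewrite sumr_const -scaler_nat linearZ scalerA mulVf ?neq0_card // scale1r.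
Qed.

End HomAverage.

(** * Multiplicities in [Xi] as traces on omega *)

Section Multiplicity.
Variables (F : finFieldType) (n k : nat).
Local Notation G := (GL F n).
Local Notation H := (GL F k).
Local Notation omx := (@omega_mx F n k).

Lemma omega_mxE (g : G) (h : H) : omx (g, h) = omx (g, 1%g) *m omx (1%g, h).
Proof. by rewrite -omega_mxM (mulg1 (g : G)) (mul1g (h : H)). Qed.

Lemma omega_mxCE (g : G) (h : H) : omx (g, h) = omx (1%g, h) *m omx (g, 1%g).
Proof. by rewrite -omega_mxM (mul1g (g : G)) (mulg1 (h : H)). Qed.

Lemma cfRepr_Xi (nu : GLhat F k) (g : G) :
  cfRepr (Xi n nu) g = #|{: H}|%:R^-1 * \sum_(h : H) 'chi_nu h^-1%g * \tr (omx (g, h)).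
Proof.
pose P := hom_average 'Chi_nu (omega_right F n k).
rewrite cfunE inE mulr1n (@mxtrace_submod _ _ _ _ _ P) ?inE //; first last.
- exact: hom_average_id.
- exact: hom_average_sub.
rewrite /P -scalemxAl mxtraceZ mulmx_suml raddf_sum /=; congr (_ * _).
apply: eq_bigr => h _; rewrite -mulmxA.
have -> : lin_mulmxr (omega_right F n k h) *m lin_mulmxr (omx (g, 1%g))
    = lin_mulmxr (omx (g, h)) :> 'M_(irr_degree (socle_of_Iirr nu) * _).
  apply/row_matrixP=> i; rewrite !rowE mulmxA !mul_rV_mulmxr mxvecK.
  by rewrite -mulmxA /= -omega_mxCE.
rewrite mxtrace_lin_mul; congr (_ * _).
by rewrite -irrRepr cfunE inE mulr1n.
Qed.

Local Notation mult rho nu := (multiplicity (Xi n nu) rho).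
Implicit Types (rho : GLhat F n) (nu : GLhat F k).

Lemma multiplicityE rho nu :
  #|{: G}|%:R * #|{: H}|%:R * mult rho nu =
    \sum_(g : G) \sum_(h : H) 'chi_rho g^-1%g * 'chi_nu h^-1%g * \tr (omx (g, h)).
Proof.
rewrite /multiplicity cfdotE cardsT.
rewrite mulrA [_ * _^-1]mulrAC divff ?neq0_card // mul1r mulr_sumr.
rewrite (eq_bigl xpredT) => [|g]; last by rewrite inE.
apply: eq_bigr => g _; rewrite cfRepr_Xi -irr_inv.
rewrite !mulrA divff ?neq0_card // mul1r mulr_suml.
by apply: eq_bigr => h _; rewrite mulrC mulrA.
Qed.

Lemma natr_multiplicity rho nu : mult rho nu \in Num.nat.
Proof. by apply: Cnat_cfdot_char_irr; apply: cfRepr_char. Qed.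

Definition left_proj (rho : GLhat F n) := isotypic_proj (omega_left F n k) rho.
Definition right_proj (nu : GLhat F k) := isotypic_proj (omega_right F n k) nu.

Lemma omega_mx_left_proj (x : G * H) rho :
  omx x *m left_proj rho = left_proj rho *m omx x.
Proof.
case: x => g h; rewrite omega_mxE -mulmxA.
rewrite [omx (1%g, h) *m _](_ : _ = left_proj rho *m omx (1%g, h)).
  by rewrite !mulmxA (isotypic_projC (omega_left F n k)).
rewrite /left_proj /isotypic_proj -[LHS]scalemxAr -[RHS]scalemxAl.
congr (_ *: _); rewrite [LHS]mulmx_sumr [RHS]mulmx_suml; apply: eq_bigr => y _.
rewrite -[LHS]scalemxAr -[RHS]scalemxAl; congr (_ *: _).
by rewrite -[LHS]omega_mxCE -[RHS]omega_mxE.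
Qed.

Lemma omega_mx_right_proj (x : G * H) nu :
  omx x *m right_proj nu = right_proj nu *m omx x.
Proof.
case: x => g h; rewrite omega_mxCE -mulmxA.
rewrite [omx (g, 1%g) *m _](_ : _ = right_proj nu *m omx (g, 1%g)).
  by rewrite !mulmxA (isotypic_projC (omega_right F n k)).
rewrite /right_proj /isotypic_proj -[LHS]scalemxAr -[RHS]scalemxAl.
congr (_ *: _); rewrite [LHS]mulmx_sumr [RHS]mulmx_suml; apply: eq_bigr => y _.
rewrite -[LHS]scalemxAr -[RHS]scalemxAl; congr (_ *: _).
by rewrite -[LHS]omega_mxE -[RHS]omega_mxCE.
Qed.

Lemma left_right_projC rho nu :
  left_proj rho *m right_proj nu = right_proj nu *m left_proj rho.
Proof.
rewrite /left_proj /isotypic_proj -[LHS]scalemxAl -[RHS]scalemxAr.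
congr (_ *: _); rewrite [LHS]mulmx_suml [RHS]mulmx_sumr.
apply: eq_bigr => y _.
by rewrite -[LHS]scalemxAl -[RHS]scalemxAr /= (omega_mx_right_proj (y, 1%g)).
Qed.

(** The nu-isotypic part is Xi_nu tensor nu. As [\tr (omx (g, y))] is a class function of [y], [h]
    may be averaged over its conjugates, and [sum_chi_conj] then splits off ['chi_nu h]. *)
Lemma mxtrace_right_proj g h nu :
  \tr (omx (g, h) *m right_proj nu) = 'chi_nu h * cfRepr (Xi n nu) g.
Proof.
have trJ (y z : H) : \tr (omx (g, (y ^ z)%g)) = \tr (omx (g, y)).
  have -> : omx (g, (y ^ z)%g) = omx (1%g, z^-1%g) *m omx (g, y) *m omx (1%g, z).
    by rewrite conjgE -!omega_mxM (mul1g (g : G)) (mulg1 (g : G)) mulgA.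
  by rewrite mxtrace_mulC mulmxA -omega_mxM (mulgV (z : H)) (mulg1 (1%g : G)) omega_mx1 mul1mx.
transitivity ('chi_nu 1%g / #|{: H}|%:R * \sum_(y : H) 'chi_nu (y^-1 * h)%g * \tr (omx (g, y))).
  rewrite /right_proj /isotypic_proj -scalemxAr mxtraceZ; congr (_ * _).
  rewrite mulmx_sumr raddf_sum /= (reindex_inj (mulgI h^-1%g)) /=.
  apply: eq_bigr => y _; rewrite -scalemxAr mxtraceZ -omega_mxM (mulg1 (g : G)).
  by rewrite mulKVg invMg invgK.
have nzH := neq0_card (GL F k); have nz1 := irr1_neq0 nu.
have -> : \sum_(y : H) 'chi_nu (y^-1 * h)%g * \tr (omx (g, y))
    = #|{: H}|%:R^-1 * \sum_(y : H) (\sum_(z : H) 'chi_nu (y^-1 * h ^ z)%g) * \tr (omx (g, y)).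
  under [in RHS]eq_bigr do rewrite mulr_suml.
  rewrite exchange_big /=.
  transitivity (#|{: H}|%:R^-1 * \sum_(z : H) \sum_(y : H) 'chi_nu (y^-1 * h)%g * \tr (omx (g, y))).
    by rewrite sumr_const -[_ *+ #|_|]mulr_natl mulKf.
  congr (_ * _); apply: eq_bigr => z _.
  rewrite [RHS](reindex_inj (@conjg_inj _ z)) /=; apply: eq_bigr => y _.
  rewrite (trJ y z); congr (_ * _).
  by rewrite -conjVg -conjMg cfunJ ?inE.
under eq_bigr do rewrite sum_chi_conj.
rewrite cfRepr_Xi.
transitivity ('chi_nu h / #|{: H}|%:R * \sum_(y : H) 'chi_nu y^-1%g * \tr (omx (g, y))).
  rewrite !mulr_sumr; apply: eq_bigr => y _; field; exact/andP.
by rewrite mulrA.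
Qed.

(** When the character of [Xi] is expanded into irreducibles, orthogonality keeps only [rho]: the
    (rho, nu)-part of omega consists of [mult rho nu] copies of rho tensor nu. *)
Lemma mxtrace_left_right_proj g h rho nu :
  \tr (omx (g, h) *m (left_proj rho *m right_proj nu)) = mult rho nu * 'chi_rho g * 'chi_nu h.
Proof.
have nzG := neq0_card (GL F n); have nz1 := irr1_neq0 rho.
rewrite /left_proj /isotypic_proj -scalemxAl -scalemxAr mxtraceZ.
rewrite mulmx_suml mulmx_sumr raddf_sum /=.
transitivity ('chi_rho 1%g / #|{: G}|%:R *
   \sum_(x : G) \sum_rho' ('chi_nu h * mult rho' nu) * ('chi_rho' (x * g)%g * 'chi_rho x^-1%g)).
  congr (_ * _); apply: eq_bigr => x _.
  rewrite -scalemxAl -scalemxAr mxtraceZ mulmxA -omega_mxM (mulg1 (h : H)).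
  rewrite mxtrace_right_proj {1}(cfun_sum_cfdot (cfRepr _)) sum_cfunE.
  rewrite !mulr_sumr; apply: eq_bigr => rho' _; rewrite cfunE.
  rewrite [(x * g)%g](_ : _ = ((g * x) ^ g)%g) ?cfunJ ?inE //; last by rewrite conjgE -mulgA mulKg.
  by rewrite /multiplicity; ring.
rewrite exchange_big /=; under eq_bigr do rewrite -mulr_sumr sum_chi_mulV.
rewrite (bigD1 rho) //= big1 => [|i /negPf ->]; last by rewrite mul0r !mulr0.
by rewrite eqxx mul1r addr0; field; rewrite nz1 nzG.
Qed.

End Multiplicity.

(** * Spectra through character sums over stabilizers *)

Section SubgroupSum.
Variables (gT : finGroupType) (S : {group gT}) (i : Iirr [set: gT]).

Let A := \sum_(s in S) 'Chi_i s.

Let irrE x : 'chi_i x = \tr ('Chi_i x).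
Proof. by rewrite -irrRepr cfunE inE mulr1n. Qed.

Let trA : \tr A = \sum_(s in S) 'chi_i s.
Proof. by rewrite raddf_sum /=; apply: eq_bigr => s _; rewrite irrE. Qed.

(** Divided by [#|S|], [A] is the projection onto the vectors fixed by [S]; a vanishing trace
    therefore forces A = 0. *)
Let rankA : \tr A = #|S|%:R * (\rank (#|S|%:R^-1 *: A))%:R.
Proof.
have nzS := neq0CG S.
have AA : A *m A = #|S|%:R *: A.
  rewrite scaler_nat -sumr_const [in LHS]/A mulmx_suml; apply: eq_bigr => s Ss.
  rewrite /A mulmx_sumr [RHS](reindex_inj (mulgI s)) /=.
  by apply: eq_big => [t | t _]; [rewrite groupMl | rewrite repr_mxM ?inE].
rewrite -mxtrace_idem; first by rewrite mxtraceZ mulrA divff ?mul1r.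
by rewrite -[LHS]scalemxAl -scalemxAr AA (scalerA _ #|S|%:R) mulVf ?scale1r.
Qed.

Lemma sum_irr_subgroup_ge0 : 0 <= \sum_(s in S) 'chi_i s.
Proof. by rewrite -trA rankA mulr_ge0 ?ler0n. Qed.

Lemma sum_irr_coset x :
  \sum_(s in S) 'chi_i s = 0 -> \sum_(s in S) 'chi_i (x * s)%g = 0.
Proof.
rewrite -trA rankA => /eqP; rewrite mulf_eq0 (negPf (neq0CG S)) /=.
rewrite pnatr_eq0 mxrank_eq0 scaler_eq0 invr_eq0 (negPf (neq0CG S)) /= => /eqP A0.
transitivity (\tr ('Chi_i x *m A)); last by rewrite A0 mulmx0 mxtrace0.
rewrite mulmx_sumr raddf_sum; apply: eq_bigr => s _.
by rewrite irrE repr_mxM ?inE.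
Qed.

End SubgroupSum.

(** [A] and [A'] arise from each other by right multiplication, hence have the same stabilizer. A
    rank below [p] is padded with zero columns. *)
Lemma mxrank_factor (F : fieldType) m n p (A : 'M[F]_(m, n)) :
  (\rank A <= p)%N ->
  exists A' : 'M_(m, p), exists B, exists C, A = A' *m B /\ A' = A *m C.
Proof.
move=> rA; have := mulmx_base A; have := row_base_free A.
move: (col_base A) (row_base A) => P Q Qfree PQ.
exists (P *m pid_mx (\rank A)), (pid_mx (\rank A) *m Q), (pinvmx Q *m pid_mx (\rank A)).
split; first by rewrite mulmxA -(mulmxA P) pid_mx_id // pid_mx_1 mulmx1.
by rewrite -[X in _ = X *m _]PQ mulmxA -(mulmxA P Q) mulmxVp // mulmx1.
Qed.

Section Spectrum.
Variables (F : finFieldType) (m : nat).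
Local Notation G := (GL F m).
Implicit Types (rho : GLhat F m).

Fact stab_group_set p (J : 'M[F]_(m, p)) :
  group_set [set g : G | GLmx g *m J == J].
Proof.
apply/group_setP; split=> [|g h]; first by rewrite inE mul1mx.
by rewrite !inE => /eqP gJ /eqP hJ; rewrite -mulmxA hJ gJ.
Qed.

Lemma sum_stab_ge0 rho p (J : 'M[F]_(m, p)) :
  0 <= \sum_(g : G | GLmx g *m J == J) 'chi_rho g.
Proof.
have := sum_irr_subgroup_ge0 (Group (stab_group_set J)) rho.
by under eq_bigl do rewrite inE.
Qed.

(** The elements taking [J] to [J'] form a left coset of the stabilizer of [J], or the empty set. *)
Lemma sum_stab_coset rho p (J J' : 'M[F]_(m, p)) :
  \sum_(g : G | GLmx g *m J == J) 'chi_rho g = 0 ->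
  \sum_(g : G | GLmx g *m J == J') 'chi_rho g = 0.
Proof.
move=> sJ; have [/existsP[x /eqP xJ]|] := boolP [exists g : G, GLmx g *m J == J'].
  rewrite (reindex_inj (mulgI x)) /=.
  have := @sum_irr_coset _ (Group (stab_group_set J)) rho x.
  have stabE g : (g \in Group (stab_group_set J)) = (GLmx g *m J == J) by rewrite inE.
  rewrite !(eq_bigl _ _ stabE) => /(_ sJ) {2}<-.
  apply: eq_bigl => g; rewrite -xJ -mulmxA.
  by rewrite (inj_eq (can_inj (mulKmx (GLmx_unit x)))).
rewrite negb_exists => /forallP noJ; rewrite big_pred0 // => g.
exact: negPf (noJ g).
Qed.

Lemma cfRepr_omega_left l (g : G) :
  cfRepr (omega_left F m l) g = \sum_(J : 'M[F]_(m, l)) (GLmx g *m J == J)%:R.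
Proof.
rewrite cfunE inE mulr1n /mxtrace (reindex_onto enum_rank enum_val) /=;
  last by move=> i _; apply: enum_valK.
rewrite (eq_bigl xpredT) => [|J]; last by rewrite enum_rankK eqxx.
apply: eq_bigr => J _; rewrite mxE /= enum_rankK invmx1 mulmx1 eq_sym //.
Qed.

(** The permutation character counts fixed matrices, so the multiplicity of [rho] is, up to the
    order of the group, the sum over all [J] of the stabilizer sums. These are nonnegative and
    cannot cancel. *)
Lemma spectrumP rho l :
  reflect (exists J : 'M[F]_(m, l), \sum_(g : G | GLmx g *m J == J) 'chi_rho g != 0)
    (rho \in spectrum F m l).
Proof.
rewrite inE /appears irr_consttE cfdotE.
have -> : (#|[set: G]|%:R^-1 * \sum_(g in [set: G]) cfRepr (omega_left F m l) g * ('chi_rho g)^*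
    = #|[set: G]|%:R^-1 * \sum_(J : 'M[F]_(m, l)) \sum_(g : G | GLmx g *m J == J) 'chi_rho g)%R.
  congr (_ * _); rewrite (eq_bigl xpredT) => [|g]; last by rewrite inE.
  under eq_bigr do rewrite cfRepr_omega_left mulr_suml.
  rewrite exchange_big /=; apply: eq_bigr => J _.
  rewrite -[RHS](conj_Creal (ger0_real (sum_stab_ge0 _ _))) rmorph_sum /=.
  rewrite [RHS]big_mkcond; apply: eq_bigr => g _.
  by case: eqP => _; rewrite ?mul1r ?mul0r.
rewrite mulf_eq0 invr_eq0 (negPf (neq0CG _)) /= psumr_neq0 => [|J _]; last exact: sum_stab_ge0.
apply: (iffP hasP) => [[J _ sJ]|[J sJ]]; exists J.
- exact: lt0r_neq0.
- exact: mem_index_enum.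
by rewrite lt_def sJ sum_stab_ge0.
Qed.

Lemma sum_stab_notin rho l p (J J' : 'M[F]_(m, p)) :
  rho \notin spectrum F m l -> (\rank J <= l)%N ->
  \sum_(g : G | GLmx g *m J == J') 'chi_rho g = 0.
Proof.
move=> rho_l /mxrank_factor[J1 [B [C [JB JC]]]]; apply: sum_stab_coset.
apply/eqP/(contraNT _ rho_l) => sJ; apply/spectrumP; exists J1.
rewrite (eq_bigl (fun g : G => GLmx g *m J == J)) // => g.
by apply/eqP/eqP => [gJ|gJ]; [rewrite JB mulmxA gJ | rewrite JC mulmxA gJ].
Qed.

Lemma spectrum_subset l l' : (l <= l')%N -> spectrum F m l \subset spectrum F m l'.
Proof.
move=> le_ll'; apply/subsetP=> rho; apply: contraLR => rho_l'.
apply/spectrumP=> -[J]; rewrite (sum_stab_notin J rho_l') ?eqxx //.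
exact: leq_trans (rank_leq_col J) le_ll'.
Qed.

Lemma mem_spectrum_full rho : rho \in spectrum F m m.
Proof.
apply/spectrumP; exists 1%:M.
rewrite (big_pred1 (1%g : G)) ?irr1_neq0 // => g.
by rewrite mulmx1.
Qed.

Lemma spectrum0 : spectrum F m 0 = [set 0].
Proof.
apply/setP=> rho; rewrite [RHS]inE.
have sumE (J : 'M[F]_(m, 0)) :
    \sum_(g : G | GLmx g *m J == J) 'chi_rho g = #|{: G}|%:R * (rho == 0)%:R.
  rewrite -cfdot_irr cfdotE cardsT mulrA divff ?neq0_card // mul1r.
  apply: eq_big => [g | g _]; first by rewrite inE (thinmx0 J) mulmx0 eqxx.
  by rewrite irr0 cfun1E inE rmorph1 mulr1.
apply/spectrumP/idP => [[J] | rho0]; last exists 0; rewrite sumE.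
  by case: (rho == 0); rewrite // mulr0 eqxx.
by rewrite rho0 mulr1 neq0_card.
Qed.

(** The empty set at index 0 lets [new_spectrumE] cover the trivial representation by the same
    difference of sets. *)
Definition old_spectrum l : {set GLhat F m} :=
  if l is l'.+1 then spectrum F m l' else set0.

Lemma new_spectrumE l : new_spectrum F m l = spectrum F m l :\: old_spectrum l.
Proof. by case: l => [|l] //=; rewrite setD0 spectrum0. Qed.

Lemma old_spectrum_subset l l' : (l <= l')%N -> old_spectrum l \subset old_spectrum l'.
Proof.
case: l l' => [|l] [|l'] // le_ll'; try exact: sub0set.
exact: (@spectrum_subset l l').
Qed.

Lemma spectrum_sub_old l l' : (l < l')%N -> spectrum F m l \subset old_spectrum l'.
Proof. by case: l' => // l'; exact: (@spectrum_subset l l'). Qed.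

Lemma mem_new_spectrum rho l :
  rho \in spectrum F m l -> exists2 l', (l' <= l)%N & rho \in new_spectrum F m l'.
Proof.
move=> rho_l; have ex_l : exists j, rho \in spectrum F m j by exists l.
case: (ex_minnP ex_l) => l' rho_l' min_l'; exists l'; first exact: min_l'.
rewrite new_spectrumE inE rho_l' andbT; case: l' min_l' {rho_l'} => [|l'] min_l' /=.
  by rewrite inE.
by apply/negP=> /min_l'; rewrite ltnn.
Qed.

(** [rE] trades the integer bound for a natural one, a negative [r] giving l = 0. The spectra
    increase and exhaust all representations, so [rho] has a new index, which is at least [l]
    exactly when [rho] has not appeared before [l]. *)
Lemma in_new_spectrum_geP rho (r : int) l :
    (forall j : nat, (r <= j%:Z) = (l <= j)%N) ->
  in_new_spectrum_ge r rho <-> rho \notin old_spectrum l.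
Proof.
move=> rE; split=> [[j [rj]]|rho_l].
  rewrite rE in rj; rewrite new_spectrumE inE => /andP[rho_j _].
  by apply: contra rho_j; apply/subsetP/old_spectrum_subset.
have [j _ rho_j] := mem_new_spectrum (mem_spectrum_full rho).
exists j; split=> //; rewrite rE leqNgt; apply: contra rho_l => ltjl.
move: rho_j; rewrite new_spectrumE inE => /andP[_].
by apply/subsetP/spectrum_sub_old.
Qed.

End Spectrum.

(** * Invariant kernels and new functions *)

(** Moebius inversion on the lattice of subspaces: the indicator of the row space [V0] is that of
    lying in [V0] minus those of the proper subspaces, which are expanded by induction on the
    rank. *)
Lemma row_space_expansion (F : finFieldType) n m (K : 'M[F]_(n, m) -> algC) :
    (forall g W, g \in unitmx -> K (g *m W) = K W) ->
  exists c : 'M[F]_m -> algC, forall W, K W = \sum_V c V * (W <= V)%MS%:R.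
Proof.
move=> Kinv.
have delta_exp r (V0 : 'M[F]_m) : (\rank V0 < r)%N -> exists c : 'M[F]_m -> algC,
    forall W : 'M_(n, m), (<<W>>%MS == <<V0>>%MS)%:R = \sum_V c V * (W <= V)%MS%:R.
  elim: r V0 => // r IHr V0 rV0.
  have /fin_all_exists[c cE] (V1 : 'M[F]_m) : exists c : 'M[F]_m -> algC,
      (V1 < V0)%MS -> forall W : 'M_(n, m),
      (<<W>>%MS == <<V1>>%MS)%:R = \sum_V c V * (W <= V)%MS%:R.
    have [/rank_ltmx ltV|_] := boolP (V1 < V0)%MS; last by exists (fun=> 0).
    have [|c cE] := IHr V1; first exact: leq_trans ltV _.
    by exists c.
  exists (fun V => (V == V0)%:R - \sum_(V1 | (V1 == <<V1>>%MS) && (V1 < V0)%MS) c V1 V).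
  move=> W; under eq_bigr do rewrite mulrBl; rewrite sumrB.
  rewrite (bigD1 V0) //= eqxx mul1r big1 => [|V /negPf->]; last by rewrite mul0r.
  under [in RHS]eq_bigr do rewrite mulr_suml.
  rewrite addr0 exchange_big /=.
  under [in RHS]eq_bigr => V1 /andP[_ ltV] do rewrite -(cE V1 ltV).
  apply/eqP; rewrite eq_sym subr_eq addrC -natr_sum.
  have ltgen : (<<W>> < V0)%MS = (W < V0)%MS by rewrite /ltmx !genmxE.
  set s := (\sum_(V1 | _) _)%N.
  have -> : s = ((W < V0)%MS : nat).
    rewrite /s; have [ltWV|] := boolP (W < V0)%MS.
      rewrite (bigD1 <<W>>%MS) /=; last by rewrite genmx_id eqxx /ltmx !genmxE.
      rewrite genmx_id eqxx big1 ?addn0 // => V1 /andP[/andP[/eqP <- _]].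
      by rewrite eq_sym => /negPf->.
    move=> nlt; apply: big1 => V1 /andP[/eqP V1E ltV]; case: eqP => // W_V1.
    by case/negP: nlt; rewrite -ltgen W_V1 -V1E.
  apply/eqP; rewrite submxElt (sameP genmxP eqP) -ltgen.
  by case: eqP => [->|_]; rewrite /ltmx ?genmxE ?submx_refl ?addr0 ?add0r.
have /fin_all_exists[c cE] (V1 : 'M[F]_m) := delta_exp _ V1 (ltnSn _).
(* A [V] that is [<<W>>] for no [W] gets the default 0. Two choices of [W] differ by a unit on the
   left, so the value does not depend on the choice. *)
pose K' V := if [pick W | <<W>>%MS == V] is Some W then K W else 0.
exists (fun V => \sum_(V1 | V1 == <<V1>>%MS) K' V1 * c V1 V) => W.
transitivity (\sum_(V1 | V1 == <<V1>>%MS) K' V1 * (<<W>>%MS == <<V1>>%MS)%:R).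
  rewrite (bigD1 <<W>>%MS) ?genmx_id ?eqxx //= big1 => [|V1 /andP[/eqP <-]].
    rewrite mulr1 addr0 /K'; case: pickP => [W' /eqP/genmxP|/(_ W)]; last by rewrite eqxx.
    by case/eqmxMunitP=> g gU ->; rewrite Kinv.
  by rewrite eq_sym => /negPf->; rewrite mulr0.
under eq_bigr do rewrite cE mulr_sumr.
rewrite exchange_big /=; apply: eq_bigr => V _; rewrite mulr_suml.
by apply: eq_bigr => V1 _; rewrite mulrA.
Qed.

Section NewFunctions.
Variables (F : finFieldType) (n k : nat).
Local Notation G := (GL F n).
Local Notation H := (GL F k).
Implicit Types (f : 'M[F]_(n, k) -> algC).

(* The two conditions express vanishing of the push-forward along X |-> X A and
   of the pull-back along Z |-> Z B, for A and B of rank less than k. *)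
Definition new_function f : Prop :=
  (forall p (A : 'M[F]_(k, p)) (Z : 'M_(n, p)), (\rank A < k)%N ->
     \sum_(Y | Y *m A == Z) f Y = 0)
  /\ (forall X, (\rank X < k)%N -> f X = 0).

(** The [g] with a given product [GLmx g *m X] form a coset of the stabilizer of [X] or the empty
    set, and ['chi_rho] sums to 0 over them. *)
Lemma sum_isotypic_lowrank (rho : GLhat F n) l p (X : 'M[F]_(n, p))
    (phi : 'M_(n, p) -> algC) :
    rho \notin spectrum F n l -> (\rank X <= l)%N ->
  \sum_(g : G) 'chi_rho g * phi (GLmx g *m X) = 0.
Proof.
move=> rho_l rX; rewrite (partition_big (fun g : G => GLmx g *m X) xpredT) //=.
apply: big1 => W _; rewrite (eq_bigr (fun g : G => 'chi_rho g * phi W)) => [|g /eqP-> //].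
by rewrite -mulr_suml (sum_stab_notin _ rho_l) ?mul0r.
Qed.

(** Both conditions reduce to [sum_isotypic_lowrank]: the push-forward along [A] is the same average
    of the push-forward of [phi], taken at Z = Y0 A, whose rank is below k. *)
Lemma new_function_isotypic (rho : GLhat F n) (phi : 'M_(n, k) -> algC) :
    rho \notin old_spectrum F n k ->
  new_function (fun X => \sum_(g : G) 'chi_rho g * phi (GLmx g *m X)).
Proof.
move=> rho_k; have [k0 | k_gt0] := posnP k; first by split=> [p A Z|X]; rewrite [X in (_ < X)%N]k0.
have{rho_k} rho_k : rho \notin spectrum F n k.-1 by rewrite -(prednK k_gt0) in rho_k.
have ltkE r : (r < k)%N = (r <= k.-1)%N by rewrite -[in LHS](prednK k_gt0) ltnS.
split=> [p A Z | X]; rewrite ltkE => rA; last exact: (sum_isotypic_lowrank _ rho_k).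
have [/existsP[Y0 /eqP Y0A]|noY] := boolP [exists Y0 : 'M_(n, k), Y0 *m A == Z]; last first.
  rewrite negb_exists in noY; rewrite big_pred0 // => Y.
  exact: negPf (forallP noY Y).
rewrite exchange_big /=.
under eq_bigr => g _.
  rewrite -mulr_sumr (reindex_inj (can_inj (mulKVmx (GLmx_unit g)))) /=.
  under eq_bigr do rewrite mulKVmx ?GLmx_unit //.
  rewrite (eq_bigl (fun Y => Y *m A == GLmx g *m Z)) => [|Y]; last first.
    by rewrite -mulmxA (can2_eq (mulKVmx (GLmx_unit g)) (mulKmx (GLmx_unit g))).
  over.
apply: (sum_isotypic_lowrank (fun W => \sum_(Y | Y *m A == W) phi Y) rho_k).
by rewrite -Y0A (leq_trans (mxrankM_maxr _ _)).
Qed.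

(** If [Q] is not row free, the sum is a push-forward of rank below k. Otherwise [Y] is [Z] times a
    matrix, so it has rank at most l and [f] vanishes there. *)
Lemma new_function_sum_small f l m (P : 'M_(l, m)) (Q : 'M_(k, m)) (Z : 'M_(n, l)) :
  new_function f -> (l < k)%N -> \sum_(Y | Y *m Q == Z *m P) f Y = 0.
Proof.
move=> [f1 f2] lk; have [rQ | Qfree] := ltnP (\rank Q) k; first exact: f1.
have Qf : row_free Q by rewrite /row_free eqn_leq rank_leq_row.
apply: big1 => Y /eqP YQ; apply: f2.
have -> : Y = Z *m (P *m pinvmx Q) by rewrite mulmxA -YQ -mulmxA mulmxVp ?mulmx1.
exact: leq_ltn_trans (mxrankM_maxl _ _) (leq_ltn_trans (rank_leq_col _) lk).
Qed.

(** When [Q] is row free, the only candidate is Y = X M with [M = P *m pinvmx Q]. A nonzero value of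
    [f] there needs rank k, which makes [M] invertible and [X] cancellable, so that M Q = P; then
    [M] is the only [h] that contributes. *)
Lemma new_function_sum_GL f m (P Q : 'M_(k, m)) (X : 'M_(n, k)) :
  new_function f ->
  \sum_(Y | Y *m Q == X *m P) f Y
    = \sum_(h : H) (row_free Q && (GLmx h *m Q == P))%:R * f (X *m GLmx h).
Proof.
move=> [f1 f2]; have [Qf /= | Qf] := boolP (row_free Q); last first.
  rewrite f1 ?big1 // => [h _|]; first by rewrite mul0r.
  by rewrite ltn_neqAle Qf rank_leq_row.
pose M := P *m pinvmx Q.
have YE Y : Y *m Q = X *m P -> Y = X *m M.
  by move=> YQ; rewrite mulmxA -YQ -mulmxA mulmxVp ?mulmx1.
have [/andP[Munit /eqP MQ] | nM] := boolP ((M \in unitmx) && (M *m Q == P)).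
  pose h0 : H := MkGL Munit.
  rewrite (big_pred1 (X *m M)) => [|Y]; last first.
    by apply/eqP/eqP => [/YE //|->]; rewrite -(mulmxA X) MQ.
  rewrite (bigD1 h0) //= MQ eqxx mul1r big1 ?addr0 // => h nh.
  have [hQ|_] := eqVneq (GLmx h *m Q) P; last by rewrite mul0r.
  case/eqP: nh; apply: val_inj; rewrite /= /M -hQ -mulmxA mulmxVp // mulmx1 //.
rewrite !big1 // => [h _|Y /eqP YQ].
  have [hQ|_] := eqVneq (GLmx h *m Q) P; last by rewrite mul0r.
  have Mh : M = GLmx h by rewrite /M -hQ -mulmxA mulmxVp ?mulmx1.
  by rewrite Mh GLmx_unit hQ eqxx in nM.
apply: f2; rewrite ltnNge; apply: contra nM => rY; have YM := YE _ YQ.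
have rM : row_free M.
  rewrite /row_free eqn_leq rank_leq_row (leq_trans rY) // YM.
  exact: mxrankM_maxr.
have rX : row_full X.
  rewrite /row_full eqn_leq rank_leq_col (leq_trans rY) // YM.
  exact: mxrankM_maxl.
rewrite -row_free_unit rM; apply/eqP/(row_full_inj rX).
by rewrite /= mulmxA -YM.
Qed.

(** The kernel depends only on the row space of (Z | Y). Lying in [V] means being killed by
    [cokermx V], whose two blocks turn this into a linear relation between [Y] and [Z]. *)
Lemma new_function_kernel_expansion l (K : 'M[F]_(n, l) -> 'M[F]_(n, k) -> algC) :
    (forall g Z Y, g \in unitmx -> K (g *m Z) (g *m Y) = K Z Y) ->
  exists c : 'M[F]_(l + k) -> algC, forall f Z, \sum_Y K Z Y * f Y =
    \sum_V c V * \sum_(Y | Y *m dsubmx (cokermx V) == Z *m - usubmx (cokermx V)) f Y.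
Proof.
move=> Kinv.
have [|c cE] := @row_space_expansion F n (l + k) (fun W => K (lsubmx W) (rsubmx W)).
  move=> g W gU /=; rewrite -[in LHS](hsubmxK W) mul_mx_row row_mxKl row_mxKr.
  exact: Kinv.
exists c => f Z; under eq_bigr => Y _.
  have := cE (row_mx Z Y); rewrite row_mxKl row_mxKr => ->; rewrite mulr_suml; over.
rewrite exchange_big /=; apply: eq_bigr => V _; rewrite mulr_sumr [RHS]big_mkcond.
apply: eq_bigr => Y _; rewrite submxE -{1}(vsubmxK (cokermx V)) mul_row_col.
rewrite addrC addr_eq0 mulmxN.
by case: eqP => _; rewrite ?mulr1 ?mulr0 ?mul0r.
Qed.

Lemma new_function_commutant (K : 'M[F]_(n, k) -> 'M[F]_(n, k) -> algC) :
    (forall g X Y, g \in unitmx -> K (g *m X) (g *m Y) = K X Y) ->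
  exists c : H -> algC, forall f X, new_function f ->
    \sum_Y K X Y * f Y = \sum_(h : H) c h * f (X *m GLmx h).
Proof.
case/new_function_kernel_expansion=> c cE.
exists (fun h => \sum_V c V * (row_free (dsubmx (cokermx V)) &&
    (GLmx h *m dsubmx (cokermx V) == - usubmx (cokermx V)))%:R) => f X newf.
rewrite cE; under eq_bigr => V _ do rewrite new_function_sum_GL // mulr_sumr.
rewrite exchange_big /=; apply: eq_bigr => h _; rewrite mulr_suml.
by apply: eq_bigr => V _; rewrite mulrA.
Qed.

Lemma new_function_orthogonal l (K : 'M[F]_(n, l) -> 'M[F]_(n, k) -> algC) f Z :
    (forall g Z Y, g \in unitmx -> K (g *m Z) (g *m Y) = K Z Y) ->
    new_function f -> (l < k)%N ->
  \sum_Y K Z Y * f Y = 0.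
Proof.
case/new_function_kernel_expansion=> c cE newf lk; rewrite cE big1 // => V _.
by rewrite new_function_sum_small ?mulr0.
Qed.

End NewFunctions.

(** * The commutant on the new part and the uniqueness of eta *)

Section Eta.
Variables (F : finFieldType) (n k : nat).
Local Notation G := (GL F n).
Local Notation H := (GL F k).
Local Notation N := #|{: 'M[F]_(n, k)}|.
Local Notation omx := (@omega_mx F n k).
Local Notation mult rho nu := (multiplicity (Xi n nu) rho).
Local Notation old := (old_spectrum F n k).
Implicit Types (rho : GLhat F n) (nu : GLhat F k).

Lemma mul_omega_mxl (g : G) (h : H) p (A : 'M_(N, p)) i j :
  (omx (g, h) *m A) i j = A (enum_rank (invmx g *m enum_val i *m h)) j.
Proof.
pose X := invmx g *m enum_val i *m h.
rewrite mxE (bigD1 (enum_rank X)) //= big1 ?addr0 => [|l nl].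
  rewrite mxE enum_rankK /X /= mulmxA mulKVmx ?GLmx_unit // mulmxK ?GLmx_unit //.
  by rewrite eqxx mul1r.
rewrite mxE /=; case: eqP => [iE|_]; last by rewrite mul0r.
case/eqP: nl; rewrite /X iE !mulmxA mulVmx ?GLmx_unit // mul1mx.
by rewrite mulmxKV ?GLmx_unit // enum_valK.
Qed.

Lemma mul_omega_mxr (g : G) (h : H) p (A : 'M_(p, N)) i j :
  (A *m omx (g, h)) i j = A i (enum_rank (GLmx g *m enum_val j *m invmx h)).
Proof.
rewrite mxE (bigD1 (enum_rank (GLmx g *m enum_val j *m invmx h))) //=.
rewrite big1 ?addr0 => [|l nl]; first by rewrite mxE enum_rankK eqxx mulr1.
rewrite mxE; case: eqP => [lE|_]; last by rewrite mulr0.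
by case/eqP: nl; rewrite -lE enum_valK.
Qed.

Definition new_columns p (A : 'M[algC]_(N, p)) : Prop :=
  forall j, new_function (fun X => A (enum_rank X) j).

Lemma new_columnsM p q (A : 'M_(N, p)) (B : 'M_(p, q)) :
  new_columns A -> new_columns (A *m B).
Proof.
move=> newA j; split=> [r C Z rC | X rX].
  under eq_bigr do rewrite mxE.
  rewrite exchange_big /= big1 // => i _.
  by rewrite -mulr_suml (newA i).1 ?mul0r.
by rewrite mxE big1 // => i _; rewrite (newA i).2 ?mul0r.
Qed.

Lemma new_columns_sum p (I : finType) (P : pred I) (A : I -> 'M_(N, p)) :
  (forall i, P i -> new_columns (A i)) -> new_columns (\sum_(i | P i) A i).
Proof.
move=> newA j; split=> [r C Z rC | X rX].
  under eq_bigr do rewrite summxE.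
  by rewrite exchange_big /= big1 // => i Pi; rewrite ((newA i Pi) j).1.
by rewrite summxE big1 // => i Pi; rewrite ((newA i Pi) j).2.
Qed.

Lemma new_columns_left_proj rho : rho \notin old -> new_columns (left_proj k rho).
Proof.
move=> rho_old j; pose c := 'chi_rho 1%g / #|{: G}|%:R.
have := new_function_isotypic (fun Y => c * (Y == enum_val j)%:R) rho_old.
have projE X : left_proj k rho (enum_rank X) j
    = \sum_(g : G) 'chi_rho g * (c * (GLmx g *m X == enum_val j)%:R).
  rewrite /left_proj /isotypic_proj mxE summxE mulr_sumr.
  rewrite (reindex_inj invg_inj) /=; apply: eq_bigr => g _.
  rewrite invgK !mxE /= enum_rankK invmx1 mulmx1 mulrCA; congr (_ * (_ * (nat_of_bool _)%:R)).
  by rewrite eq_sym (can2_eq (mulKVmx (GLmx_unit g)) (mulKmx (GLmx_unit g))) eq_sym.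
case=> f1 f2; split=> [p A Z rA | X rX]; last by rewrite projE f2.
by under eq_bigr do rewrite projE; apply: f1.
Qed.

Lemma commutant_new_columns (T : 'M_N) :
    (forall g : G, omx (g, 1%g) *m T = T *m omx (g, 1%g)) ->
  exists c : H -> algC, forall p (A : 'M_(N, p)), new_columns A ->
    T *m A = \sum_(h : H) c h *: (omx (1%g, h) *m A).
Proof.
move=> Tcomm.
have [|c cE] := @new_function_commutant F n k (fun X Y => T (enum_rank X) (enum_rank Y)).
  move=> g X Y gU; pose g' : G := MkGL gU.
  have := congr1 (fun A : 'M_N => A (enum_rank (g *m X)) (enum_rank Y)) (Tcomm g').
  rewrite mul_omega_mxl mul_omega_mxr !enum_rankK /= invmx1 !mulmx1 mulKmx //.
exists c => p A newA; apply/matrixP=> i j; rewrite mxE summxE.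
transitivity (\sum_Y T (enum_rank (enum_val i)) (enum_rank Y) * A (enum_rank Y) j).
  rewrite enum_valK (reindex_onto enum_rank enum_val) => [|l _] /=; last exact: enum_valK.
  by apply: eq_bigl => Y; rewrite enum_rankK eqxx.
rewrite cE //; apply: eq_bigr => h _; rewrite mxE mul_omega_mxl /=.
by rewrite invmx1 mul1mx.
Qed.

(** Every [rho] outside [spectrum F n k] contributes the zero operator, so the image is the new part
    of omega. *)
Definition new_proj : 'M[algC]_N := \sum_(rho | rho \notin old) left_proj k rho.

Lemma new_projK : new_proj *m new_proj = new_proj.
Proof.
rewrite {1 3}/new_proj mulmx_suml; apply: eq_bigr => rho rho_old.
rewrite /new_proj mulmx_sumr (bigD1 rho) //= big1 ?addr0 => [|rho' /andP[_ nrho]].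
  by rewrite isotypic_projM eqxx scale1r.
by rewrite isotypic_projM eq_sym (negPf nrho) scale0r.
Qed.

Lemma omega_new_projC x : omx x *m new_proj = new_proj *m omx x.
Proof.
rewrite mulmx_suml mulmx_sumr; apply: eq_bigr => rho _.
exact: omega_mx_left_proj.
Qed.

Lemma new_right_projC nu : new_proj *m right_proj n nu = right_proj n nu *m new_proj.
Proof.
rewrite mulmx_suml mulmx_sumr; apply: eq_bigr => rho _.
exact: left_right_projC.
Qed.

(** On the new part [T] is a combination of operators of GL_k. Since [T] commutes with GL_k, it may
    be averaged under conjugation; each [h] then becomes a class sum, hence a scalar on the
    nu-isotypic part. *)
Lemma new_isotypic_scalar nu (T : 'M_N) :
    (forall x, omx x *m T = T *m omx x) ->
  exists c : algC, T *m (new_proj *m right_proj n nu) = c *: (new_proj *m right_proj n nu).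
Proof.
move=> Tcomm; have [c cE] := commutant_new_columns (fun g => Tcomm (g, 1%g)).
have [E EE] : exists E, E = new_proj *m right_proj n nu by eexists.
rewrite -EE; have newE : new_columns E.
  by rewrite EE; apply/new_columnsM/new_columns_sum => rho; apply: new_columns_left_proj.
have Ecomm x : omx x *m E = E *m omx x.
  by rewrite EE mulmxA omega_new_projC -!mulmxA omega_mx_right_proj.
have ETcomm x : omx x *m (T *m E) = T *m E *m omx x.
  by rewrite [LHS]mulmxA Tcomm -[RHS]mulmxA -Ecomm [RHS]mulmxA.
exists (\sum_(h : H) c h * ('chi_nu h / 'chi_nu 1%g)).
have nzH := neq0_card H.
apply: (scalerI nzH).
transitivity (\sum_(z : H) omx (1%g, z^-1%g) *m (T *m E) *m omx (1%g, z)).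
  rewrite scaler_nat -sumr_const; apply: eq_bigr => z _.
  rewrite -mulmxA -ETcomm mulmxA -omega_mxM (mulVg (z : H)) (mulg1 (1%g : G)).
  by rewrite omega_mx1 mul1mx.
transitivity (\sum_(z : H) \sum_(h : H) c h *: (omx (1%g, (h ^ z)%g) *m E)).
  apply: eq_bigr => z _; rewrite cE // mulmx_sumr mulmx_suml.
  apply: eq_bigr => h _; rewrite -scalemxAr -scalemxAl; congr (_ *: _).
  rewrite -!mulmxA -Ecomm !mulmxA; congr (_ *m E).
  by rewrite -!omega_mxM !(mulg1 (1%g : G)) conjgE mulgA.
rewrite exchange_big scaler_suml scaler_sumr /=; apply: eq_bigr => h _.
rewrite -scaler_sumr -mulmx_suml EE new_right_projC mulmxA.
rewrite (sum_conj_isotypic_proj (omega_right F n k)) -scalemxAl !scalerA.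
by congr (_ *: _); ring.
Qed.

Lemma mxtrace_new_right_proj g h nu :
  \tr (omx (g, h) *m (new_proj *m right_proj n nu))
    = \sum_(rho | rho \notin old) mult rho nu * 'chi_rho g * 'chi_nu h.
Proof.
rewrite mulmx_suml mulmx_sumr raddf_sum /=; apply: eq_bigr => rho _.
exact: mxtrace_left_right_proj.
Qed.

Lemma new_right_projK nu :
  let E := new_proj *m right_proj n nu in E *m E = E.
Proof.
rewrite /= {1}new_right_projC mulmxA -(mulmxA _ new_proj new_proj) new_projK.
by rewrite -new_right_projC -mulmxA isotypic_projM eqxx scale1r.
Qed.

(** [trace_scalar_commutant] is applied to the projection [E] onto the new nu-isotypic part, whose
    trace is nonzero because of [rho0] and cancels. One factor [mult rho nu] comes from the trace
    against [E], the other from [multiplicityE]. *)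
Lemma sum_sqr_multiplicity nu rho0 :
    rho0 \notin old -> mult rho0 nu != 0 ->
  \sum_(rho | rho \notin old) mult rho nu ^+ 2 = 1.
Proof.
move=> rho0_old m0; set E := new_proj *m right_proj n nu.
have mge0 rho : 0 <= mult rho nu by rewrite natr_ge0 ?natr_multiplicity.
have trE : \tr E != 0.
  have -> : E = omx (1%g, 1%g) *m E by rewrite omega_mx1 mul1mx.
  rewrite mxtrace_new_right_proj psumr_neq0; last first.
    by move=> rho _; rewrite 2?pmulr_lge0 ?irr1_gt0 ?mge0.
  apply/hasP; exists rho0; rewrite ?mem_index_enum // rho0_old /=.
  by rewrite 2?pmulr_lgt0 ?irr1_gt0 // lt0r m0 mge0.
have Ecomm x : omx x *m E = E *m omx x.
  by rewrite mulmxA omega_new_projC -!mulmxA omega_mx_right_proj.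
have := trace_scalar_commutant (rG := omega F n k) (new_right_projK nu) Ecomm
  (@new_isotypic_scalar nu).
rewrite -/E [RHS]mulrC => /(mulfI trE).
rewrite -(pair_bigA _ (fun g h => \tr (omx (g, h)) * \tr (omx (g^-1%g, h^-1%g) *m E))) /=.
under eq_bigr => g _.
  under eq_bigr => h _.
    rewrite mxtrace_new_right_proj mulr_sumr; over.
  rewrite exchange_big /=; over.
rewrite exchange_big /= card_prod natrM => sumE.
have nzG := neq0_card G; have nzH := neq0_card H.
apply: (mulfI (mulf_neq0 nzG nzH)); rewrite mulr1 -[RHS]sumE mulr_sumr.
apply: eq_bigr => rho _; rewrite expr2 mulrA multiplicityE mulr_suml.
apply: eq_bigr => g _; rewrite mulr_suml; apply: eq_bigr => h _.
by ring.
Qed.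

Lemma multiplicity_new_unique nu rho0 :
    rho0 \notin old -> mult rho0 nu != 0 ->
  mult rho0 nu = 1 /\
  forall rho, rho \notin old -> rho != rho0 -> mult rho nu = 0.
Proof.
move=> rho0_old m0; have := sum_sqr_multiplicity rho0_old m0.
have /fin_all_exists[m mE] rho : exists m : nat, mult rho nu = m%:R.
  by exists (Num.truncn (mult rho nu)); rewrite truncnK ?natr_multiplicity.
under eq_bigr do rewrite mE -natrX; rewrite -natr_sum => /eqP.
rewrite (eqr_nat _ _ 1) (bigD1 rho0) //= => sum1.
have m0_gt0 : (0 < m rho0 ^ 2)%N by rewrite expn_gt0 lt0n -(eqr_nat algC) -mE m0.
have /andP[/eqP m01 /eqP rest0] : (m rho0 ^ 2 == 1)%N &&
    (\sum_(rho | (rho \notin old) && (rho != rho0)) m rho ^ 2 == 0)%N.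
  by move: sum1 m0_gt0; case: (m rho0 ^ 2)%N => [|[|a]] // ; rewrite add1n eqSS => ->.
split=> [|rho rho_old nrho].
  by rewrite mE; move/eqP: m01; rewrite -{2}(exp1n 2) eqn_exp2r // => /eqP->.
have /eqP := rest0; rewrite sum_nat_eq0 => /forallP/(_ rho).
by rewrite rho_old nrho /= mE expn_eq0 andbT => /eqP->.
Qed.

Lemma cfRepr_omega_left_Xi :
  cfRepr (omega_left F n k) = \sum_(nu : GLhat F k) 'chi_nu 1%g *: cfRepr (Xi n nu).
Proof.
apply/cfunP=> g; rewrite sum_cfunE [LHS]cfunE inE mulr1n.
transitivity (\tr (omx (g, 1%g) *m \sum_(nu : GLhat F k) right_proj n nu)).
  by rewrite (sum_isotypic_proj (omega_right F n k)) mulmx1.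
rewrite mulmx_sumr raddf_sum /=; apply: eq_bigr => nu _.
by rewrite mxtrace_right_proj [RHS]cfunE.
Qed.

Lemma multiplicity_spectrum rho nu : mult rho nu != 0 -> rho \in spectrum F n k.
Proof.
move=> m0; rewrite inE /appears irr_consttE cfRepr_omega_left_Xi cfdot_suml.
have mge0 nu' : 0 <= mult rho nu' by rewrite natr_ge0 ?natr_multiplicity.
under eq_bigr do rewrite cfdotZl.
rewrite psumr_neq0 => [|nu' _]; last by rewrite pmulr_rge0 ?irr1_gt0 ?mge0.
apply/hasP; exists nu; rewrite ?mem_index_enum //=.
by rewrite pmulr_rgt0 ?irr1_gt0 // lt_def m0 mge0.
Qed.

(** Let chi' be the character of L^2(M_{n,k-1}). The sum of chi'(g) g^-1 kills new functions,
    because its values come from invariant kernels between M_{n,k-1} and M_{n,k}. It is also a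
    combination of the [left_proj], with nonzero coefficient at [rho] since [rho] occurs in chi'. *)
Lemma left_proj_old_new_columns rho p (A : 'M_(N, p)) :
  rho \in old -> new_columns A -> left_proj k rho *m A = 0.
Proof.
move=> rho_old newA; have [k0 | k_gt0] := posnP k.
  by move: rho_old; rewrite [X in old_spectrum _ _ X]k0 inE.
have{rho_old} rho_k : rho \in spectrum F n k.-1 by rewrite -(prednK k_gt0) in rho_old.
pose chi' := cfRepr (omega_left F n k.-1).
have sum_chi' : \sum_(g : G) chi' g *: (omx (g^-1%g, 1%g) *m A) = 0.
  apply/matrixP=> i j; rewrite summxE !mxE.
  under eq_bigr do rewrite mxE mul_omega_mxl /= invmxK mulmx1 /chi' cfRepr_omega_left mulr_suml.
  rewrite exchange_big big1 //= => Z _.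
  (* [K W Y] counts the [g] sending [Z] to [W] and the matrix of index [i] to [Y]; it is invariant,
     and it is used at W = Z. *)
  pose K W Y := \sum_(g : G) (GLmx g *m Z == W)%:R * (GLmx g *m enum_val i == Y)%:R : algC.
  transitivity (\sum_Y K Z Y * A (enum_rank Y) j).
    under [RHS]eq_bigr do rewrite mulr_suml.
    rewrite exchange_big /=; apply: eq_bigr => g _.
    rewrite (bigD1 (GLmx g *m enum_val i)) //= eqxx mulr1 big1 ?addr0 // => Y nY.
    by rewrite [_ == Y]eq_sym (negPf nY) mulr0 mul0r.
  apply: (new_function_orthogonal (l := k.-1)) (newA j) _; last by rewrite prednK.
  move=> x W Y xU; pose x' : G := MkGL xU.
  rewrite /K (reindex_inj (mulgI x')) /=; apply: eq_bigr => g _.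
  by rewrite -!mulmxA !(inj_eq (can_inj (mulKmx xU))).
pose c i := '[chi', 'chi_i] * (#|{: G}|%:R / 'chi_i 1%g).
have projE : \sum_(g : G) chi' g *: omx (g^-1%g, 1%g) = \sum_i c i *: left_proj k i.
  under eq_bigr => g _ do rewrite (cfun_sum_cfdot chi') sum_cfunE scaler_suml.
  rewrite exchange_big /=; apply: eq_bigr => i _.
  rewrite /c -scalerA; under eq_bigr do rewrite cfunE -scalerA.
  rewrite -scaler_sumr; congr (_ *: _).
  rewrite /left_proj /isotypic_proj scalerA.
  have -> : #|{: G}|%:R / 'chi_i 1%g * ('chi_i 1%g / #|{: G}|%:R) = 1.
    by have := irr1_neq0 i; have := neq0_card G => ? ?; field; apply/andP.
  rewrite scale1r (reindex_inj invg_inj); apply: eq_bigr => g _ /=.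
  by rewrite invgK.
have : c rho *: (left_proj k rho *m A) = 0.
  rewrite -(mulmx0 _ (left_proj k rho)) -sum_chi'.
  under [in RHS]eq_bigr do rewrite scalemxAl.
  rewrite -mulmx_suml projE mulmxA mulmx_sumr (bigD1 rho) //= big1 ?addr0 => [|i ni].
    by rewrite -scalemxAr isotypic_projM eqxx scale1r scalemxAl.
  by rewrite -scalemxAr isotypic_projM eq_sym (negPf ni) scale0r scaler0.
move/eqP; rewrite scaler_eq0 => /orP[|/eqP//].
have nz : #|{: G}|%:R / 'chi_rho 1%g != 0.
  by rewrite mulf_neq0 ?neq0_card // invr_eq0 irr1_neq0.
rewrite /c mulf_eq0 (negPf nz) orbF.
by move: rho_k; rewrite inE /appears irr_consttE => /negPf->.
Qed.
End Eta.

(** * Vanishing stabilizer sums, which bound the domain of eta *)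

Lemma card_mulmx_ker (F : finFieldType) m n (A : 'M[F]_(m, n)) :
  #|[set u : 'cV_n | A *m u == 0]| = (#|F| ^ (n - \rank A))%N.
Proof.
rewrite -mxrank_tr -mxrank_ker -card_rowg -(card_imset _ (@trmx_inj _ _ _)).
congr #|pred_of_set _|; apply/setP=> v; rewrite inE sub_kermx.
apply/imsetP/eqP => [[u] | vA].
  by rewrite inE => /eqP uA ->; rewrite -trmx_mul uA trmx0.
by exists v^T; rewrite ?trmxK // inE -[A]trmxK -trmx_mul vA trmx0.
Qed.

Lemma prodr_natb (R : comNzRingType) (I : finType) (b : pred I) :
  \prod_i (b i)%:R = [forall i, b i]%:R :> R.
Proof.
case: forallP => [bT | nb]; first by rewrite big1 // => i _; rewrite bT.
have /existsP[i /negPf nbi] : [exists i, ~~ b i].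
  by rewrite -negb_forall; apply/forallP.
by rewrite (bigD1 i) //= nbi mul0r.
Qed.

Section StabilizerSum.
Variables (F : finFieldType) (n k : nat).
Local Notation H := (GL F k).
Local Notation q := #|F|.

(** The power counts [i]-tuples of solutions. For a fixed tuple the conditions prescribe the product
    of [X] with a matrix of r + i < k columns, so the sum is a push-forward of low rank. *)
Lemma new_function_sum_power (f : 'M[F]_(n, k) -> algC) r (J : 'M_(k, r)) (X0 : 'M_(n, k)) i :
    new_function f -> (r + i < k)%N ->
  \sum_(X | X *m J == X0 *m J)
     f X * (#|[set u : 'cV_(k + k) | row_mx X X0 *m u == 0]|%:R) ^+ i = 0.
Proof.
move=> [f1 _] rik.
have powE X : (#|[set u : 'cV_(k + k) | row_mx X X0 *m u == 0]|%:R) ^+ i =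
    \sum_(phi : {ffun 'I_i -> 'cV[F]_(k + k)}) [forall j, row_mx X X0 *m phi j == 0]%:R :> algC.
  rewrite -sum1_card natr_sum big_mkcond /=.
  rewrite -[i in LHS]card_ord -prodr_const bigA_distr_bigA /=.
  by apply: eq_bigr => phi _; rewrite -prodr_natb; apply: eq_bigr => j _; rewrite inE; case: eqP.
under eq_bigr do rewrite powE mulr_sumr.
rewrite exchange_big /= big1 // => phi _.
pose S := \matrix_(a < k, j < i) usubmx (phi j) a 0.
pose T := \matrix_(a < k, j < i) dsubmx (phi j) a 0.
transitivity (\sum_(X | X *m row_mx J S == X0 *m row_mx J (- T)) f X); last first.
  by apply: f1; apply: leq_ltn_trans (rank_leq_col _) rik.
rewrite [LHS]big_mkcond [RHS]big_mkcond; apply: eq_bigr => X _ /=.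
rewrite !mul_mx_row.
have -> : (row_mx (X *m J) (X *m S) == row_mx (X0 *m J) (X0 *m - T))
   = (X *m J == X0 *m J) && [forall j, row_mx X X0 *m phi j == 0].
  have phiE j : (row_mx X X0 *m phi j == 0) = (X *m usubmx (phi j) == X0 *m - dsubmx (phi j)).
    by rewrite -{1}(vsubmxK (phi j)) mul_row_col addr_eq0 mulmxN.
  have entry (Y : 'M_(n, k)) (v : 'I_i -> 'cV_k) a j :
      (Y *m \matrix_(b, l) v l b 0) a j = (Y *m v j) a 0.
    by rewrite !mxE; apply: eq_bigr => b _; rewrite mxE.
  have TE : - T = \matrix_(a < k, j < i) (- dsubmx (phi j)) a 0.
    by apply/matrixP=> a j; rewrite !mxE.
  apply/eqP/andP => [/eq_row_mx[-> XS] | [/eqP -> /forallP XS]].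
    split=> //; apply/forallP=> j; rewrite phiE; apply/eqP/colP => a.
    by have := congr1 (fun A : 'M_(n, i) => A a j) XS; rewrite TE !entry.
  congr row_mx; apply/matrixP=> a j; rewrite TE !entry.
  by have := XS j; rewrite phiE => /eqP->.
by case: eqP; case: forallP; rewrite ?mulr1 ?mulr0.
Qed.

Lemma row_mx_full_rank (X X0 : 'M[F]_(n, k)) :
    \rank X0 = k -> \rank X = k -> \rank (row_mx X X0) = k ->
  exists h : H, X = X0 *m h.
Proof.
move=> rX0 rX rXX0.
have sub : (X^T <= X0^T)%MS.
  have le0 : (X0^T <= col_mx X^T X0^T)%MS by rewrite -addsmxE addsmxSr.
  have le1 : (X^T <= col_mx X^T X0^T)%MS by rewrite -addsmxE addsmxSl.
  apply: submx_trans le1 _.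
  by rewrite -(geq_leqif (mxrank_leqif_sup le0)) -tr_row_mx !mxrank_tr rX0 rXX0.
have XE : X = X0 *m (X^T *m pinvmx X0^T)^T 
  by apply: trmx_inj; rewrite trmx_mul trmxK mulmxKpV.
have hU : (X^T *m pinvmx X0^T)^T \in unitmx.
  rewrite -row_free_unit /row_free eqn_leq rank_leq_row -[X in (X <= _)%N]rX [X in \rank X]XE.
  exact: mxrankM_maxr.
by exists (MkGL hU).
Qed.

Lemma new_function_sum_stab (f : 'M[F]_(n, k) -> algC) r (J : 'M_(k, r)) (X0 : 'M_(n, k)) :
    new_function f -> (n + r < k + k)%N -> (r < k)%N ->
  \sum_(h : H | GLmx h *m J == J) f (X0 *m h) = 0.
Proof.
move=> newf nrk rk; have [rX0 | leX0] := ltnP (\rank X0) k.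
  by apply: big1 => h _; apply: newf.2; apply: leq_ltn_trans (mxrankM_maxl _ _) rX0.
have{leX0} rX0 : \rank X0 = k by apply/eqP; rewrite eqn_leq rank_leq_col.
have X0full : row_full X0 by rewrite /row_full rX0.
(* The roots are q^(r+1), ..., q^(k-1). The degree k - r - 1 puts each monomial within reach of
   [new_function_sum_power], and q^k is not a root. *)
pose rs : seq algC := [seq (q ^ j)%:R | j <- iota r.+1 (k - r.+1)].
pose p := \prod_(a <- rs) ('X - a%:P).
have size_p : size p = (k - r)%N.
  by rewrite size_prod_XsubC size_map size_iota -subSn // subSS.
have q_gt1 : (1 < q)%N := finRing_gt1 F.
have rootp j : root p (q ^ j)%:R = (r < j < k)%N.
  rewrite root_prod_XsubC; apply/mapP/idP => [[l] | rjk].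
    rewrite mem_iota subnKC // => rlk /eqP; rewrite eqr_nat eqn_exp2l // => /eqP->.
    by case/andP: rlk => -> .
  by exists j; rewrite // mem_iota subnKC.
pose Nu X : algC := #|[set u : 'cV_(k + k) | row_mx X X0 *m u == 0]|%:R.
have sum_p : \sum_(X | X *m J == X0 *m J) f X * p.[Nu X] = 0.
  under eq_bigr do rewrite horner_coef mulr_sumr.
  rewrite exchange_big /= big1 // => i _.
  under eq_bigr do rewrite mulrCA.
  rewrite -mulr_sumr new_function_sum_power ?mulr0 //.
  by have := ltn_ord i; rewrite [X in (_ < X)%N]size_p ltn_subRL.
have pk : p.[(q ^ k)%:R] != 0 by rewrite -rootE rootp ltnn andbF.
have leRk X : (k <= \rank (row_mx X X0))%N.
  by rewrite -[X in (X <= _)%N]rX0 -mxrank_tr -[X in (_ <= X)%N]mxrank_tr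
    tr_row_mx -addsmxE mxrankS ?addsmxSr.
(* The rank of (X | X0) lies between k and n, so the number of solutions is q^e with r < 2k - n <= e
   <= k. *)
have pNu X : p.[Nu X] = (\rank (row_mx X X0) == k)%:R * p.[(q ^ k)%:R].
  rewrite /Nu card_mulmx_ker; case: eqP => [-> | /eqP nk]; first by rewrite addnK mul1r.
  rewrite mul0r; apply/eqP; rewrite -rootE rootp.
  have ltk : (k < \rank (row_mx X X0))%N by rewrite ltn_neqAle eq_sym nk leRk.
  have len : (\rank (row_mx X X0) <= n)%N := rank_leq_row _.
  have Rr : (\rank (row_mx X X0) + r <= n + r)%N by rewrite leq_add2r.
  rewrite ltn_subRL (leq_ltn_trans Rr nrk) /=.
  by rewrite ltn_subLR ?ltn_add2r // rank_leq_col.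
suff: (\sum_(h : H | GLmx h *m J == J) f (X0 *m h)) * p.[(q ^ k)%:R] = 0.
  by move/eqP; rewrite mulf_eq0 (negPf pk) orbF => /eqP.
rewrite -[RHS]sum_p.
under [in RHS]eq_bigr do rewrite pNu mulrA.
rewrite -mulr_suml; congr (_ * _).
have injX0 : {in [set h : H | GLmx h *m J == J] &, injective (fun h : H => X0 *m GLmx h)}.
  by move=> h h' _ _ /(row_full_inj X0full)/val_inj.
transitivity (\sum_(X in [set X0 *m GLmx h | h in [set h : H | GLmx h *m J == J]]) f X).
  by rewrite big_imset //=; apply: eq_bigl => h; rewrite inE.
rewrite [LHS]big_mkcond [RHS]big_mkcond; apply: eq_bigr => X _ /=.
case: imsetP => [[h] | nh].
  rewrite inE => /eqP hJ ->; rewrite -mulmxA hJ eqxx.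
  suff -> : \rank (row_mx (X0 *m h) X0) == k by rewrite mulr1.
  rewrite eqn_leq leRk andbT -{2}[X0]mulmx1 -mul_mx_row.
  by rewrite (leq_trans (mxrankM_maxl _ _)) // rX0.
(* A remaining [X] of joint rank k either has rank below k, where [f] vanishes, or is X0 h with [h]
   fixing [J], which [nh] excludes. *)
case: eqP => // XJ; case: eqP => [rXX0|]; last by rewrite mulr0.
have [rX | leX] := ltnP (\rank X) k; first by rewrite newf.2 // mul0r.
have rX : \rank X = k by apply/eqP; rewrite eqn_leq rank_leq_col.
have [h Xh] := row_mx_full_rank rX0 rX rXX0.
case: nh; exists h; rewrite // inE; apply/eqP/(row_full_inj X0full).
by rewrite /= mulmxA -Xh.
Qed.

(** The trace of the vanishing sum over the stabilizer is a sum over [nu'] of multiplicities times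
    stabilizer sums. All terms are nonnegative, so each is 0, and the nonzero multiplicity of [nu]
    leaves its stabilizer sum to vanish. *)
Lemma multiplicity_new_notin_spectrum r (rho : GLhat F n) (nu : GLhat F k) :
    rho \notin old_spectrum F n k -> multiplicity (Xi n nu) rho != 0 ->
    (n + r < k + k)%N -> (r < k)%N ->
  nu \notin spectrum F k r.
Proof.
move=> rho_old m0 nrk rk; apply/spectrumP=> -[J /eqP[]].
have mge0 nu' : 0 <= multiplicity (Xi n nu') rho by rewrite natr_ge0 ?natr_multiplicity.
have sum0 : \sum_(h : H | GLmx h *m J == J) omega_mx (1%g : GL F n, h) *m left_proj k rho = 0.
  apply/matrixP=> i j; rewrite summxE mxE.
  under eq_bigr do rewrite mul_omega_mxl /= invmx1 mul1mx.
  exact: (new_function_sum_stab _ _ (new_columns_left_proj rho_old j) nrk rk).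
have tr0 : \sum_(nu' : GLhat F k) (multiplicity (Xi n nu') rho * 'chi_rho 1%g)
    * \sum_(h : H | GLmx h *m J == J) 'chi_nu' h = 0.
  transitivity (\tr (\sum_(h : H | GLmx h *m J == J)
      omega_mx (1%g : GL F n, h) *m left_proj k rho)); last by rewrite sum0 mxtrace0.
  rewrite raddf_sum /=; under eq_bigr do rewrite mulr_sumr.
  rewrite exchange_big /=; apply: eq_bigr => h _.
  rewrite -[left_proj k rho]mulmx1 -(sum_isotypic_proj (omega_right F n k)).
  rewrite !mulmx_sumr raddf_sum /=; apply: eq_bigr => nu' _.
  by rewrite mxtrace_left_right_proj.
move/psumr_eq0P: tr0 => /(_ _ nu isT) mult0.
have /eqP : multiplicity (Xi n nu) rho * 'chi_rho 1%g
    * \sum_(h : H | GLmx h *m J == J) 'chi_nu h = 0.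
  apply: mult0 => nu' _; rewrite mulr_ge0 ?sum_stab_ge0 //.
  by rewrite pmulr_lge0 ?irr1_gt0 ?mge0.
by rewrite mulf_eq0 mulf_eq0 (negPf m0) (negPf (irr1_neq0 rho)) => /eqP.
Qed.

End StabilizerSum.

(** * A new function with nonzero nu-isotypic part *)

Lemma sum_row_mx (V : nmodType) (F : finNzRingType) m n1 n2 (f : 'M[F]_(m, n1 + n2) -> V) :
  \sum_D f D = \sum_C \sum_E f (row_mx C E).
Proof.
rewrite pair_bigA /= (reindex (fun p : 'M_(m, n1) * 'M_(m, n2) => row_mx p.1 p.2)) //=.
exists (fun D => (lsubmx D, rsubmx D)) => [[C E] _ | D _] /=; last exact: hsubmxK.
by rewrite row_mxKl row_mxKr.
Qed.

Lemma sum_col_mx (V : nmodType) (F : finNzRingType) m1 m2 n (f : 'M[F]_(m1 + m2, n) -> V) :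
  \sum_D f D = \sum_C \sum_E f (col_mx C E).
Proof.
rewrite pair_bigA /= (reindex (fun p : 'M_(m1, n) * 'M_(m2, n) => col_mx p.1 p.2)) //=.
exists (fun D => (usubmx D, dsubmx D)) => [[C E] _ | D _] /=; last exact: vsubmxK.
by rewrite col_mxKu col_mxKd.
Qed.

Section RankWeight.
Variables (F : finFieldType) (b : nat).
Local Notation q := #|F|.

(* The recurrence rank_weightS makes the sum of the weights of the ranks of
   Y + y v over all columns y vanish: the rank is \rank Y for q ^ \rank Y of them
   and (\rank Y).+1 for the others. *)
Definition rank_weight z : algC := \prod_(i < z) (- (q ^ i)%:R / ((q ^ b)%:R - (q ^ i)%:R)).

Lemma rank_weightS z :
  (z < b)%N -> (q ^ z)%:R * rank_weight z + ((q ^ b)%:R - (q ^ z)%:R) * rank_weight z.+1 = 0.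
Proof.
move=> zb; rewrite {2}/rank_weight big_ord_recr /= -/(rank_weight z).
have nz : (q ^ b)%:R - (q ^ z)%:R != 0 :> algC.
  rewrite subr_eq0 eqr_nat eqn_exp2l ?finRing_gt1 //.
  by rewrite gtn_eqF.
by rewrite mulrC [_ * (- _ / _)]mulrC mulrA mulrCA mulfV // mulr1 mulNr addrC mulrC addNr.
Qed.

(** Right multiplication recovers both [y] and [Y] from Y + y v, because v a = 1 and Y a = 0. Its
    columns thus span the same space as those of (Y | y). *)
Lemma mxrank_add_outer k (Y : 'M[F]_(b, k)) (y : 'cV_b) (v : 'rV_k) (a : 'cV_k) :
    v *m a = 1%:M -> Y *m a = 0 ->
  \rank (Y + y *m v)%R = (\rank Y + ~~ (y^T <= Y^T)%MS)%N.
Proof.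
move=> va Ya.
have -> : \rank (Y + y *m v)%R = \rank (row_mx Y y).
  apply/eqP; rewrite eqn_leq; apply/andP; split.
    by have := mxrankM_maxl (row_mx Y y) (col_mx 1%:M v); rewrite mul_row_col mulmx1.
  have <- : (Y + y *m v) *m row_mx (1%:M - a *m v) a = row_mx Y y.
    have Yya : (Y + y *m v) *m a = y by rewrite mulmxDl Ya add0r -mulmxA va mulmx1.
    by rewrite mul_mx_row mulmxBr mulmx1 mulmxA Yya addrK.
  exact: mxrankM_maxl.
rewrite -mxrank_tr tr_row_mx -addsmxE -[in RHS]mxrank_tr.
have [yY | nyY] := boolP (y^T <= Y^T)%MS.
  by rewrite addn0; apply/eqmx_rank; rewrite addsmxSl addsmx_sub submx_refl yY.
apply/eqP; rewrite eqn_leq; apply/andP; split.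
  rewrite (leq_trans (mxrank_adds_leqif _ _)) // leq_add2l.
  exact: rank_leq_row.
rewrite addn1; apply: rank_ltmx; rewrite /ltmx addsmxSl /=.
by apply: contra nyY => /(submx_trans (addsmxSr _ _)).
Qed.

Lemma sum_rank_weight k (Y : 'M[F]_(b, k)) (v : 'rV_k) (a : 'cV_k) :
    v *m a = 1%:M -> Y *m a = 0 -> (\rank Y < b)%N ->
  \sum_(y : 'cV_b) rank_weight (\rank (Y + y *m v)%R) = 0.
Proof.
move=> va Ya rY; rewrite (reindex (fun u : 'rV_b => u^T)) /=; last first.
  by exists trmx => u _; exact: trmxK.
rewrite (bigID (mem (rowg Y^T))) /=.
rewrite (eq_bigr (fun=> rank_weight (\rank Y))) => [|u]; last first.
  by rewrite inE (mxrank_add_outer _ va Ya) trmxK => ->; rewrite addn0.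
rewrite [X in _ + X](eq_bigr (fun=> rank_weight (\rank Y).+1)) => [|u]; last first.
  by rewrite inE (mxrank_add_outer _ va Ya) trmxK => ->; rewrite addn1.
rewrite !sumr_const -[X in X + _]mulr_natl -[X in _ + X]mulr_natl -[RHS](rank_weightS rY).
have card_in : #|rowg Y^T| = (q ^ \rank Y)%N by rewrite card_rowg mxrank_tr.
have card_out : (#|[predC rowg Y^T]| + q ^ \rank Y = q ^ b)%N.
  by rewrite -card_in addnC cardC card_mx mul1n.
have -> : (q ^ b)%:R - (q ^ \rank Y)%:R = #|[predC rowg Y^T]|%:R :> algC.
  by rewrite -card_out natrD addrK.
by rewrite -card_in; congr (_%:R * _ + _%:R * _); apply: eq_card => u.
Qed.

End RankWeight.

Section NewVector.
Variables (F : finFieldType) (b k : nat) (nu : GLhat F k).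
Local Notation H := (GL F k).
Local Notation q := #|F|.
Hypothesis nu_old : nu \notin old_spectrum F k (k - b).

(** ['chi_nu] extended by 0 to singular matrices. *)
Let chi0 (M : 'M[F]_k) : algC := \sum_(h : H | GLmx h == M) 'chi_nu h.

(* Summing over the lines Y + y v separates the weight from the sum over C: the
   former sums to 0 when the lower block of Y has rank less than b modulo v, and
   otherwise the latter runs over a coset {h : h J = M J} with
   \rank J = k - b - 1, over which nu sums to 0. *)
Definition new_vector (Y : 'M[F]_(k + b, k)) : algC :=
  rank_weight F b (\rank (dsubmx Y)) *
  \sum_(C : 'M_(k, b)) chi0 (usubmx Y + C *m dsubmx Y).

Lemma chi0_GL (h : H) : chi0 h = 'chi_nu h.
Proof. by rewrite /chi0 (big_pred1 h) // => h'; rewrite /= (inj_eq val_inj). Qed.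

Lemma chi0_lowrank M : (\rank M < k)%N -> chi0 M = 0.
Proof.
move=> rM; rewrite /chi0 big_pred0 // => h; apply/eqP=> hM.
by rewrite -hM mxrank_unit ?GLmx_unit ?ltnn in rM.
Qed.

(** As [W] is row free, M + D W runs exactly once through the matrices that agree with [M] after
    multiplication by [cokermx W], which has rank k - b - 1. *)
Lemma sum_chi0_coset (M : 'M_k) (W : 'M[F]_(b + 1, k)) :
  row_free W -> \sum_(D : 'M_(k, b + 1)) chi0 (M + D *m W) = 0.
Proof.
move=> Wfree; have rW : \rank W = (b + 1)%N by apply/eqP.
have bk : (b < k)%N by rewrite -[(b < k)%N]/(b.+1 <= k)%N -addn1 -rW rank_leq_col.
have nu_r : nu \notin spectrum F k (k - b).-1.
  by move: nu_old; rewrite -{1}(prednK (_ : 0 < k - b)%N) // subn_gt0.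
rewrite -[RHS](sum_stab_notin (J := cokermx W) (M *m cokermx W) nu_r); last first.
  by rewrite mxrank_coker rW addn1 subnS.
under eq_bigr do rewrite /chi0 big_mkcond.
rewrite exchange_big [RHS]big_mkcond; apply: eq_bigr => h _ /=.
have -> : (GLmx h *m cokermx W == M *m cokermx W) = (GLmx h - M <= W)%MS.
  by rewrite submxE mulmxBl subr_eq0.
have [hMW | hMW] := boolP (GLmx h - M <= W)%MS; last first.
  rewrite big1 // => D _; case: eqP => // hE; case/negP: hMW.
  by rewrite hE addrC addKr submxMl.
rewrite (bigD1 ((GLmx h - M) *m pinvmx W)) //= mulmxKpV // [M + _]addrC subrK eqxx.
rewrite big1 ?addr0 // => D nD; case: eqP => // hE; case/eqP: nD.
by rewrite hE addrC addKr -mulmxA mulmxVp // mulmx1.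
Qed.

Lemma sum_new_vector_outer (v : 'rV_k) (a : 'cV_k) (Y : 'M_(k + b, k)) :
    v *m a = 1%:M -> Y *m a = 0 ->
  \sum_(y : 'cV_(k + b)) new_vector (Y + y *m v) = 0.
Proof.
move=> va Ya; pose Y1 := usubmx Y; pose Y2 := dsubmx Y.
have Y2a : Y2 *m a = 0 by rewrite /Y2 mul_dsub_mx Ya linear0.
pose L := \sum_(C : 'M_(k, b)) \sum_(y1 : 'cV_k) chi0 (Y1 + C *m Y2 + y1 *m v).
rewrite sum_col_mx exchange_big /=.
transitivity (\sum_(y2 : 'cV_b) rank_weight F b (\rank (Y2 + y2 *m v)%R) * L).
  apply: eq_bigr => y2 _.
  under eq_bigr => y1 _.
    rewrite /new_vector !linearD /= mul_col_mx col_mxKu col_mxKd -/Y1 -/Y2; over.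
  rewrite -mulr_sumr exchange_big /=; congr (_ * _); apply: eq_bigr => C _.
  (* The shift by C y2 absorbs the change of the lower block, so the inner sum no longer depends on
     [y2]. *)
  rewrite (reindex_inj (addIr (- (C *m y2)))) /=; apply: eq_bigr => y1 _.
  congr chi0; rewrite mulmxDr mulmxBl !mulmxA.
  by rewrite -addrA addrACA addNr addr0 [y1 *m v + _]addrC addrA.
rewrite -mulr_suml; have [rY2 | leY2] := ltnP (\rank Y2) b.
  by rewrite (sum_rank_weight va Y2a rY2) mul0r.
suff -> : L = 0 by rewrite mulr0.
have Y2free : row_free Y2 by rewrite /row_free eqn_leq rank_leq_row.
have Wfree : row_free (col_mx Y2 v).
  have /row_freeP[B YB] := Y2free.
  (* The factor 1 - a v corrects [B] so that [v] kills it, without changing its product with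
     [Y2]. *)
  apply/row_freeP; exists (row_mx ((1%:M - a *m v) *m B) a).
  rewrite mul_col_row !mulmxA !mulmxBr !mulmx1 !mulmxA Y2a va mul0mx mul1mx subr0 subrr.
  by rewrite mul0mx YB scalar_mx_block.
rewrite -(sum_chi0_coset Y1 Wfree) sum_row_mx; apply: eq_bigr => C _.
by apply: eq_bigr => y1 _; rewrite mul_row_col addrA.
Qed.

Lemma new_function_new_vector : new_function new_vector.
Proof.
split=> [p A Z rA | Y rY]; last first.
  rewrite /new_vector big1 ?mulr0 // => C _; apply: chi0_lowrank.
  suff -> : usubmx Y + C *m dsubmx Y = row_mx 1%:M C *m Y.
    exact: leq_ltn_trans (mxrankM_maxr _ _) rY.
  by rewrite -[in RHS](vsubmxK Y) mul_row_col mul1mx.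
have [v vn0 vA] : exists2 v : 'rV_k, v != 0 & v *m A = 0.
  have : kermx A != 0 by rewrite -mxrank_eq0 mxrank_ker subn_eq0 -ltnNge.
  by case/rowV0Pn=> v /sub_kermxP vA vn0; exists v.
have /row_freeP[a va] : row_free v by rewrite /row_free rank_rV vn0.
have N1 Y : \sum_(y : 'cV_(k + b)) new_vector (Y + y *m v) = 0.
  (* [Y'] kills [a] and differs from [Y] by a multiple of [v], so it gives the same sum over [y]. *)
  pose Y' := Y - Y *m a *m v.
  have Y'a : Y' *m a = 0 by rewrite mulmxBl -(mulmxA _ v) va mulmx1 subrr.
  rewrite (reindex_inj (addIr (- (Y *m a)))) -[RHS](sum_new_vector_outer va Y'a) /=.
  by apply: eq_bigr => y _; rewrite mulmxBl [y *m v - _]addrC addrA.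
have nzq : #|{: 'cV[F]_(k + b)}|%:R != 0 :> algC.
  by rewrite pnatr_eq0 -lt0n; apply/card_gt0P; exists 0.
apply: (mulfI nzq); rewrite mulr0.
(* Since v A = 0, adding y v permutes the fiber over [Z], and the sum may be averaged over [y]. *)
transitivity (\sum_(y : 'cV_(k + b)) \sum_(Y | Y *m A == Z) new_vector (Y + y *m v)).
  rewrite mulr_natl -sumr_const; apply: eq_bigr => y _.
  rewrite (reindex_inj (addIr (y *m v))) /=; apply: eq_bigl => Y.
  by rewrite mulmxDl -(mulmxA y) vA mulmx0 addr0.
by rewrite exchange_big big1.
Qed.

(** The nu-projection of the new function has a nonzero component at some [rho]. This [rho] is not
    old, because old projections kill new functions, and its multiplicity is nonzero, because an
    idempotent of trace 0 is 0. *)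
Lemma exists_new_multiplicity :
  exists2 rho : GLhat F (k + b),
    rho \notin old_spectrum F (k + b) k & multiplicity (Xi (k + b) nu) rho != 0.
Proof.
pose v : 'cV[algC]_#|{: 'M[F]_(k + b, k)}| := \col_i new_vector (enum_val i).
have newv : new_columns v.
  move=> j; have [N1 N2] := new_function_new_vector.
  split=> [p A Z rA | X rX]; last by rewrite mxE enum_rankK N2.
  by under eq_bigr do rewrite mxE enum_rankK; exact: N1.
pose R := right_proj (k + b) nu.
have Rv : R *m v != 0.
  (* At [col_mx 1%:M 0] the action of [h] reads [new_vector] at [col_mx h 0], where the weight is 1
     and every [C] gives ['chi_nu h]; orthogonality makes the resulting sum nonzero. *)
  apply/eqP => /matrixP/(_ (enum_rank (col_mx 1%:M 0)) 0).
  rewrite /R /right_proj /isotypic_proj -scalemxAl mulmx_suml !mxE summxE.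
  under eq_bigr => h _.
    rewrite -scalemxAl mxE mul_omega_mxl /= enum_rankK invmx1 mul1mx mul_col_mx mul1mx mul0mx.
    rewrite mxE enum_rankK /new_vector col_mxKu col_mxKd mxrank0 /rank_weight big_ord0 mul1r.
    under eq_bigr do rewrite mulmx0 addr0 chi0_GL.
    rewrite sumr_const -mulr_natl mulrCA; over.
  rewrite -mulr_sumr; have := sum_chi_mulV nu nu 1%g.
  rewrite eqxx divff ?irr1_neq0 // !mulr1.
  under eq_bigr do rewrite mulg1 mulrC.
  move=> ->; apply/eqP; rewrite !mulf_neq0 ?invr_eq0 ?irr1_neq0 ?neq0_card //.
have /existsP[rho rhoRv] : [exists rho : GLhat F (k + b), left_proj k rho *m (R *m v) != 0].
  apply: contraR Rv; rewrite negb_exists => /forallP rho0.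
  rewrite -[R *m v]mul1mx -(sum_isotypic_proj (omega_left F (k + b) k)) mulmx_suml.
  by rewrite big1 // => rho _; apply/eqP; rewrite -[_ == 0]negbK; exact: rho0.
exists rho.
  apply: contraNN rhoRv => rho_old.
  by rewrite mulmxA left_right_projC -mulmxA left_proj_old_new_columns ?mulmx0.
apply: contraNN rhoRv => /eqP m0; rewrite mulmxA.
suff -> : left_proj k rho *m R = 0 by rewrite mul0mx.
apply/eqP; rewrite -mxrank_eq0 -(eqr_nat algC) -mxtrace_idem.
  have := mxtrace_left_right_proj 1%g 1%g rho nu.
  by rewrite omega_mx1 mul1mx m0 !mul0r => ->.
rewrite {1}left_right_projC mulmxA -(mulmxA R) isotypic_projM eqxx scale1r.
by rewrite -left_right_projC -mulmxA isotypic_projM eqxx scale1r.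
Qed.

End NewVector.

Theorem theorem0p4p8 (F : finFieldType) (n k : nat)
    (hkn : (k <= n)%N) (hn : (1 <= n)%N) :
  (forall nu : GLhat F k,
     in_eta_domain n nu <-> in_new_spectrum_ge (2 * k%:Z - n%:Z) nu)
  /\
  (forall nu : GLhat F k, in_new_spectrum_ge (2 * k%:Z - n%:Z) nu ->
     exists eta_nu : GLhat F n,
       [/\ unique (fun rho : GLhat F n => is_eta nu rho) eta_nu,
           multiplicity (Xi n nu) eta_nu = 1
         & forall sigma : GLhat F n,
             appears (Xi n nu) sigma -> sigma <> eta_nu ->
             exists l : nat, (l < k)%N /\ sigma \in new_spectrum F n l]).
Proof.
(* For k <= n the truncated difference k - (n - k) is the maximum of 0 and 2k - n. *)
have geP (nu : GLhat F k) :
    in_new_spectrum_ge (2 * k%:Z - n%:Z) nu <-> nu \notin old_spectrum F k (k - (n - k)).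
  apply: in_new_spectrum_geP => j; lia.
have appearsE (nu : GLhat F k) (rho : GLhat F n) :
    appears (Xi n nu) rho = (multiplicity (Xi n nu) rho != 0).
  by rewrite /appears irr_consttE.
have etaP (nu : GLhat F k) (rho : GLhat F n) :
    is_eta nu rho <-> multiplicity (Xi n nu) rho != 0 /\ rho \notin old_spectrum F n k.
  rewrite /is_eta appearsE new_spectrumE inE; split=> [[-> /andP[]] | [m0 ->]] //.
  by rewrite m0 (multiplicity_spectrum m0).
have exists_eta (nu : GLhat F k) : nu \notin old_spectrum F k (k - (n - k)) ->
    exists2 rho : GLhat F n, rho \notin old_spectrum F n k & multiplicity (Xi n nu) rho != 0.
  move=> nu_old; have := @exists_new_multiplicity F (n - k) k nu nu_old.
  by rewrite subnKC.
split=> [nu | nu /geP /exists_eta[rho rho_old m0]].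
  rewrite geP; split=> [[rho /etaP[m0 rho_old]] | /exists_eta[rho rho_old m0]]; last first.
    by exists rho; apply/etaP.
  (* At 0 the old spectrum is empty. Otherwise r = 2k - n - 1, the largest value for which the
     stabilizer sums are shown to vanish. *)
  case kr: (k - (n - k))%N => [|r] /=; first by rewrite inE.
  by apply: (multiplicity_new_notin_spectrum rho_old m0); lia.
have [m1 m_old] := multiplicity_new_unique rho_old m0.
exists rho; split=> //.
  split=> [|sigma /etaP[ms sigma_old]]; first exact/etaP.
  by apply/eqP; apply: contraNT ms => nrho; rewrite m_old 1?eq_sym.
move=> sigma; rewrite appearsE => ms /eqP n_sigma.
have sigma_old : sigma \in old_spectrum F n k.
  by apply: contraNT ms => sigma_old; rewrite m_old.
move: sigma_old; case: (k) => [|k'] /=; first by rewrite inE.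
by case/mem_new_spectrum=> l lk' sigma_l; exists l.
Qed.
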